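(* Let $N\ge1$ be an integer, let $1<p<\infty$, let $b\in\mathbb{C}$ satisfy $$|b|\ge1+\frac{1}{N+1}\left(1-\frac{2}{p}\right),$$ and define $$a=\frac{|b|+\sqrt{|b|^2-\frac{4}{N+1}\left(1-\frac{2}{p}\right)}}{2}\,\operatorname{sgn}b .$$ Then the extremal function in $A^p$ for the functional with kernel $z^N+b$ (that is, the unique $F\in A^p$ with $\|F\|_{A^p}=1$ maximizing $\operatorname{Re}\int_{\mathbb{D}}F(z)\,\overline{(z^N+b)}\,d\sigma(z)$ among all functions in $A^p$ of norm $1$) is $$F(z)=\operatorname{sgn}\!\left(a^{1-(2/p)}\right)\frac{(z^N+a)^{2/p}}{\left(|a|^2+1/(N+1)\right)^{1/p}} .$$ Here the branch of $(z^N+a)^{2/p}$, analytic in $\mathbb{D}$, may be chosen arbitrarily, but the value of $\operatorname{sgn}(a^{1-(2/p)})$ must be chosen consistently with this choice.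
   Context: $\mathbb{D}$ is the open unit disc in $\mathbb{C}$ and $\sigma$ is area measure normalized so that $\sigma(\mathbb{D})=1$. For $1<p<\infty$, $A^p$ is the Bergman space of analytic functions $f$ on $\mathbb{D}$ with $\|f\|_{A^p}=\left(\int_{\mathbb{D}}|f|^p\,d\sigma\right)^{1/p}<\infty$. With $1/p+1/q=1$, the functional on $A^p$ with kernel $k\in A^q$ is $\phi(f)=\int_{\mathbb{D}}f\,\overline{k}\,d\sigma$. For nonzero $\phi$, the extremal function is the unique $F\in A^p$ with $\|F\|_{A^p}=1$ and $\operatorname{Re}\phi(F)=\sup_{\|g\|_{A^p}=1}\operatorname{Re}\phi(g)$. For complex $w\ne0$, $\operatorname{sgn}w=w/|w|$. Consistency of branches means $a^{1-(2/p)}=a/a^{2/p}$, where $a^{2/p}$ is the value at $z=0$ of the chosen branch of $(z^N+a)^{2/p}$. *)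

(* Defs.v *)
From HB Require Import structures.
From mathcomp Require Import all_boot all_order all_algebra.
From mathcomp Require Import complex.
From mathcomp Require Import all_classical all_reals all_analysis.

Set Implicit Arguments.
Unset Strict Implicit.
Unset Printing Implicit Defensive.

Import Order.TTheory GRing.Theory Num.Theory.
Import numFieldNormedType.Exports.

(* The modulus as an element of R, whereas `|z| for z : R[i] is in R[i]. *)
Notation normc := ComplexField.Normc.normc.

Local Open Scope classical_set_scope.
Local Open Scope ring_scope.
Local Open Scope complex_scope.

Section Bergman.
Variable R : realType.
Implicit Types (p : R) (f k F : R[i] -> R[i]) (z : R[i]).

Definition unit_disc : set R[i] := [set z | normc z < 1].

(* Derivability over the field R[i] is complex differentiability; the disc is
   open, so the values of f outside of it are irrelevant. *)
Definition analytic_on_disc f : Prop :=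
  forall z, unit_disc z -> derivable (f : R[i]^o -> R[i]^o) z 1.

(* Lebesgue measure on R^2 divided by pi; used only for integrals over the
   disc, which has measure 1. *)
Definition sigma :
    {measure set (measurableTypeR R * measurableTypeR R) -> \bar R} :=
  mscale (NngNum (divr_ge0 ler01 (pi_ge0 R)))
    (@lebesgue_measure R \x @lebesgue_measure R)%E.

Definition of_plane (u : R * R) : R[i] := u.1 +i* u.2.

Definition disc_cintegral f : R[i] :=
  (\int[sigma]_(u in of_plane @^-1` unit_disc) complex.Re (f (of_plane u)))
  +i* (\int[sigma]_(u in of_plane @^-1` unit_disc) complex.Im (f (of_plane u))).

Definition bergman_norm p f : \bar R :=
  ((\int[sigma]_(u in of_plane @^-1` unit_disc)
      (normc (f (of_plane u)) `^ p)%:E) `^ p^-1)%E.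

Definition bergman_space p f : Prop :=
  analytic_on_disc f /\ (bergman_norm p f < +oo)%E.

Definition kernel_functional k f : R[i] :=
  disc_cintegral (fun z => f z * conjc (k z)).

(* The supremum is taken in the extended reals, so that it is meaningful
   without a boundedness side condition. *)
Definition is_extremal p k F : Prop :=
  [/\ bergman_space p F,
      bergman_norm p F = 1%E &
      (complex.Re (kernel_functional k F))%:E =
      ereal_sup [set (complex.Re (kernel_functional k g))%:E
                | g in [set g | bergman_space p g /\ bergman_norm p g = 1%E]]].

(* Elements of the Bergman space are represented by total functions on R[i];
   two of them are the same when they agree on the disc. *)
Definition is_unique_extremal p k F : Prop :=
  is_extremal p k F /\
  forall G, is_extremal p k G -> forall z, unit_disc z -> G z = F z.

Definition csgn z : R[i] := z / (normc z)%:C.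

Definition cexp z : R[i] :=
  (expR (complex.Re z))%:C * (cos (complex.Im z) +i* sin (complex.Im z)).

(* h is an analytic branch on the disc of f ^ s, that is exp (s * log f) for an
   analytic branch of log f. *)
Definition is_power_branch f (s : R) (h : R[i] -> R[i]) : Prop :=
  exists L : R[i] -> R[i],
    [/\ analytic_on_disc L,
        forall z, unit_disc z -> cexp (L z) = f z &
        forall z, unit_disc z -> h z = cexp (s%:C * L z)].

End Bergman.

(* Main.v *)
From HB Require Import structures.
Require Import Defs.
From mathcomp Require Import all_boot all_order all_algebra.
From mathcomp Require Import complex.
From mathcomp Require Import all_classical all_reals all_analysis.
From mathcomp Require Import measurable_realfun.
From mathcomp Require Import ring lra.
Import Order.TTheory GRing.Theory Num.Theory.
Import numFieldNormedType.Exports.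
Local Open Scope classical_set_scope.
Local Open Scope ring_scope.
Local Open Scope complex_scope.

Set Implicit Arguments.
Unset Strict Implicit.
Unset Printing Implicit Defensive.

(** Put [s = 1 - 2 / p], [c = s / (N + 1)], and let [g] be the branch of
    [(z ^+ N + a) ^ s] with [g * h = z ^+ N + a], where [h] is the given branch
    of [(z ^+ N + a) ^ (2 / p)].

    Duality. The function [|w| ^ p] lies above its tangent at [F z], strictly
    except at the point of contact ([normc_powR_tangent]), and the gradient there
    is [p] times the dual function [|F| ^ p / F = |F| ^ (p - 2) * conj F].
    Integrating this inequality over the disc shows that a unit vector [F]
    without zeros is the unique extremal function of a kernel [k] as soon as
    [int f * |F| ^ p / F] is a positive multiple of the functional of [k] for
    every [f] ([extremal_criterion]). As the integrand that remains is
    non-negative and continuous, equality of the values forces equality of the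
    functions at every point.

    The identity to be checked. For the announced [F] the dual function is a
    multiple of [g * conj (z ^+ N + a)]. Pairing an analytic function with
    [conj (z ^+ N + a)] extracts its Taylor coefficients of orders [N] and [0].
    Those of [f * g] are [f_N * g 0 + f_0 * (s * g 0 / a)] and [f_0 * g 0], since
    [g] is a function of [z ^+ N]. The result is [g 0] times the pairing of [f]
    with [conj (z ^+ N + b)], because the definition of [a] says exactly that
    [conj b = conj a + c / a] ([root_facts]). The hypothesis on [|b|] makes
    [|a| >= 1], so that [z ^+ N + a] has no zeros and branches exist.

    Taylor coefficients enter only through means over circles
    ([pairing_shift]): on [|z| = r] one has [conj z ^+ N = r ^ (2 * N) / z ^+ N],
    so the integrand becomes the real part of a function [k] that is holomorphic
    in the punctured disc with a limit at [0], and its mean over the circle is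
    that limit ([circle_mean]). This mean value property is Goursat's lemma
    ([goursat]) in logarithmic coordinates. Since the rotations preserve area, by
    Fubini a function and its circular means have the same integral over the disc
    ([disc_average]), and the radial integrals left over are
    [int |z| ^ (2 * n) = 1 / (n + 1)] ([disc_moment]). Working circle by circle
    matters: when [|a| = 1] and [p] is close to [1], [f * g] need not be
    integrable, although [f * g * conj (z ^+ N + a)] is. *)

(** * Modulus and complex derivatives *)

Section Modulus.
Variable R : realType.
Implicit Types z w : R[i].

Lemma normcK z : `|z| = (normc z)%:C.
Proof. by case: z. Qed.

Lemma normc_ge0 z : 0 <= normc z.
Proof. by case: z => x y; exact: sqrtr_ge0. Qed.

Lemma sqr_normcE z : normc z ^+ 2 = complex.Re z ^+ 2 + complex.Im z ^+ 2.
Proof. by case: z => x y; rewrite /= sqr_sqrtr// addr_ge0// sqr_ge0. Qed.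

Lemma normcD z w : normc (z + w) <= normc z + normc w.
Proof. by rewrite -lecR rmorphD -!normcK ler_normD. Qed.

Lemma normcM z w : normc (z * w) = normc z * normc w.
Proof. exact: ComplexField.Normc.normcM. Qed.

Lemma normcB_sym z w : normc (z - w) = normc (w - z).
Proof. by apply: complexI; rewrite -!normcK distrC. Qed.

Lemma normcN z : normc (- z) = normc z.
Proof. by apply: complexI; rewrite -!normcK normrN. Qed.

Lemma normc0 : normc (0 : R[i]) = 0.
Proof. exact: ComplexField.Normc.normc0. Qed.

Lemma normc1 : normc (1 : R[i]) = 1.
Proof. exact: ComplexField.Normc.normc1. Qed.

Lemma normc_gt0 z : (0 < normc z) = (z != 0).
Proof. by rewrite -ltcR -normcK normr_gt0. Qed.

Lemma normcX z n : normc (z ^+ n) = normc z ^+ n.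
Proof. by apply: complexI; rewrite rmorphXn -!normcK normrX. Qed.

Lemma normcV z : normc z^-1 = (normc z)^-1.
Proof. exact: ComplexField.Normc.normcV. Qed.

Lemma normc_real (x : R) : normc x%:C = `|x|.
Proof. by rewrite /= expr0n/= addr0 sqrtr_sqr. Qed.

Lemma normc_conj z : normc (conjc z) = normc z.
Proof. by case: z => x y /=; rewrite sqrrN. Qed.

Lemma normc_Re z : `|complex.Re z| <= normc z.
Proof.
rewrite -(ler_pXn2r (n := 2)) ?nnegrE ?normc_ge0// sqr_normcE real_normK ?num_real//.
by rewrite lerDl sqr_ge0.
Qed.

Lemma normc_Im z : `|complex.Im z| <= normc z.
Proof.
rewrite -(ler_pXn2r (n := 2)) ?nnegrE ?normc_ge0// sqr_normcE real_normK ?num_real//.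
by rewrite lerDr sqr_ge0.
Qed.

Lemma normc_le_ReIm z : normc z <= `|complex.Re z| + `|complex.Im z|.
Proof.
case: z => x y /=.
rewrite -(ler_pXn2r (n := 2)) ?nnegrE ?sqrtr_ge0 ?addr_ge0//.
rewrite sqr_sqrtr ?addr_ge0 ?sqr_ge0// sqrrD !real_normK ?num_real//.
by rewrite addrAC lerDl mulrn_wge0// mulr_ge0.
Qed.

Lemma ReD z w : complex.Re (z + w) = complex.Re z + complex.Re w.
Proof. by case: z w => ? ? []. Qed.

Lemma ReB z w : complex.Re (z - w) = complex.Re z - complex.Re w.
Proof. by case: z w => ? ? []. Qed.

Lemma ImB z w : complex.Im (z - w) = complex.Im z - complex.Im w.
Proof. by case: z w => ? ? []. Qed.

Lemma ReZ (x : R) z : complex.Re (x%:C * z) = x * complex.Re z.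
Proof. by case: z => a b /=; rewrite mul0r subr0. Qed.

Lemma mul_conjc z : z * conjc z = (normc z ^+ 2)%:C.
Proof.
rewrite sqr_normcE; case: z => x y /=; simpc.
by congr (_ +i* _); ring.
Qed.

End Modulus.

Section ComplexDerivative.
Variable R : realType.
Implicit Types (f g : R[i] -> R[i]) (z w d : R[i]).

(** Frechet form of complex differentiability. Moduli are taken in [R], so that
    estimates can be combined with those for real functions. *)
Definition cderiv f z d := forall e : R, 0 < e -> exists2 r, 0 < r &
  forall h, normc h < r -> normc (f (z + h) - f z - d * h) <= e * normc h.

Definition ccont f z := forall e : R, 0 < e -> exists2 r, 0 < r &
  forall w, normc (w - z) < r -> normc (f w - f z) < e.

Lemma nbhs_cP z (P : R[i] -> Prop) :
  nbhs (z : R[i]^o) P <->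
  exists2 r : R, 0 < r & forall w, normc (w - z) < r -> P w.
Proof.
split.
  rewrite -nbhs_ballE => -[e /= e0 eP].
  have eR : e = (complex.Re e)%:C by rewrite RRe_real// gtr0_real.
  exists (complex.Re e); first by rewrite -ltcR -eR.
  move=> w wz; apply: eP; rewrite -ball_normE /ball_/= distrC.
  by rewrite normcK eR ltcR.
case=> r r0 rP; rewrite -nbhs_ballE; exists (r%:C) => /=; first by rewrite ltcR.
by move=> w; rewrite -ball_normE /ball_/= distrC normcK ltcR; exact: rP.
Qed.

Lemma ccontP f z : {for z, continuous (f : R[i]^o -> R[i]^o)} <-> ccont f z.
Proof.
split=> [cf e e0|cf].
  have /cf : nbhs (f z : R[i]^o) [set w | normc (w - f z) < e].
    by apply/nbhs_cP; exists e.
  by move=> /nbhs_cP.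
move=> A /nbhs_cP[e e0 eA]; apply/nbhs_cP.
have [r r0 rf] := cf _ e0; exists r => // w /rf; exact: eA.
Qed.

Lemma derivable_cderivP f z :
  derivable (f : R[i]^o -> R[i]^o) z 1 <-> exists d, cderiv f z d.
Proof.
split=> [/cvg_ex[/= d dP]|[d dP]].
  exists d => e e0.
  have : nbhs (d : R[i]^o) [set w | normc (w - d) < e] by apply/nbhs_cP; exists e.
  move=> /dP /nbhs_cP[r r0 rP]; exists r => // h hr.
  have [->|h0] := eqVneq h 0.
    by rewrite addr0 subrr mulr0 subr0 normc0 mulr0.
  have := rP h; rewrite subr0 => /(_ hr h0)/=.
  rewrite /shift/= /GRing.scale/= mulr1 (addrC h).
  move=> /ltW H; rewrite -ler_pdivrMr ?normc_gt0//.
  rewrite -normcV -normcM (le_trans _ H)// le_eqVlt; apply/orP; left.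
  by apply/eqP; congr normc; field.
apply/cvg_ex; exists (d : R[i]^o) => A /nbhs_cP[e e0 eA].
have e20 : 0 < e / 2 by rewrite divr_gt0.
have [r r0 rP] := dP _ e20.
apply/nbhs_cP; exists r => // h; rewrite subr0 => hr h0; apply: eA.
rewrite /shift/= /GRing.scale/= mulr1 (addrC h).
have := rP _ hr; rewrite -ler_pdivrMr ?normc_gt0//.
rewrite -normcV -normcM => H.
rewrite (@le_lt_trans _ _ (e / 2))//; last by rewrite ltr_pdivrMr// ltr_pMr// ltr1n.
rewrite (le_trans _ H)// le_eqVlt; apply/orP; left.
by apply/eqP; congr normc; field.
Qed.

Lemma cderiv_ccont f z d : cderiv f z d -> ccont f z.
Proof.
move=> df; apply/ccontP/differentiable_continuous/derivable1_diffP.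
by apply/derivable_cderivP; exists d.
Qed.

Lemma derivable_ccont f z : derivable (f : R[i]^o -> R[i]^o) z 1 -> ccont f z.
Proof. by move=> /derivable_cderivP[d /cderiv_ccont]. Qed.

Lemma derivable_ccomp f g z : derivable (f : R[i]^o -> R[i]^o) z 1 ->
  derivable (g : R[i]^o -> R[i]^o) (f z) 1 ->
  derivable ((fun x => g (f x)) : R[i]^o -> R[i]^o) z 1.
Proof.
move=> /derivable1_diffP df /derivable1_diffP dg; apply/derivable1_diffP.
exact: (@differentiable_comp _ _ _ _ (f : R[i]^o -> R[i]^o) (g : R[i]^o -> R[i]^o)).
Qed.

Lemma derivable_cexpr n z : derivable ((fun x => x ^+ n) : R[i]^o -> R[i]^o) z 1.
Proof.
have -> : (fun x : R[i]^o => x ^+ n) = (id : R[i]^o -> R[i]^o) ^+ n.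
  by apply/funext => x; rewrite fctE.
exact/derivableX/derivable_id.
Qed.

End ComplexDerivative.

(** * Exponential and logarithm *)

Section RealDerivative.
Variable R : realType.

Lemma is_derive_frechet (f : R -> R) (x d : R) : is_derive x 1 f d ->
  forall e : R, 0 < e -> exists2 r, 0 < r &
  forall h, `|h| < r -> `|f (x + h) - f x - d * h| <= e * `|h|.
Proof.
case=> /cvg_ex[/= l lP] dE e e0.
have {dE} ld : l = d by rewrite -dE; apply/esym/cvg_lim.
rewrite {}ld in lP.
have : nbhs d [set w | `|w - d| < e].
  by apply/nbhs_ballP; exists e => //= y; rewrite /ball/= distrC.
move=> /lP/nbhs_ballP[r /= r0 rP]; exists r => // h hr.
have [->|h0] := eqVneq h 0.
  by rewrite addr0 subrr mulr0 subr0 normr0 mulr0.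
have := rP h; rewrite /ball/= sub0r normrN => /(_ hr h0)/=.
rewrite /shift/= /GRing.scale/= mulr1 (addrC h) => /ltW H.
rewrite -ler_pdivrMr ?normr_gt0//.
rewrite -normfV -normrM (le_trans _ H)// le_eqVlt; apply/orP; left.
by apply/eqP; congr `|_|; field.
Qed.

End RealDerivative.

Section ComplexExponential.
Variable R : realType.
Implicit Types z w : R[i].

Lemma Re_cexp z : complex.Re (cexp z) = expR (complex.Re z) * cos (complex.Im z).
Proof. by rewrite /cexp /=; simpc. Qed.

Lemma Im_cexp z : complex.Im (cexp z) = expR (complex.Re z) * sin (complex.Im z).
Proof. by rewrite /cexp /=; simpc. Qed.

Lemma cexp0 : cexp (0 : R[i]) = 1.
Proof. by rewrite /cexp /= expR0 cos0 sin0; simpc. Qed.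

Lemma cexpD z w : cexp (z + w) = cexp z * cexp w.
Proof.
case: z w => x y [u v]; rewrite /cexp /= expRD cosD sinD; simpc => /=.
by congr (_ +i* _); ring.
Qed.

Lemma normc_cexp z : normc (cexp z) = expR (complex.Re z).
Proof.
rewrite /cexp normcM normc_real ger0_norm ?expR_ge0//=.
by rewrite cos2Dsin2 sqrtr1 mulr1.
Qed.

Lemma cexp_neq0 z : cexp z != 0.
Proof. by rewrite -normc_gt0 normc_cexp expR_gt0. Qed.

Lemma cexpN z : cexp (- z) = (cexp z)^-1.
Proof.
by apply: (mulfI (cexp_neq0 z)); rewrite -cexpD subrr cexp0 divff// cexp_neq0.
Qed.

Lemma cexp2pi z : cexp (z + (0 +i* (pi *+ 2))) = cexp z.
Proof.
by rewrite cexpD [X in _ * X](_ : _ = 1) ?mulr1// /cexp /= expR0 cos2pi sin2pi; simpc.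
Qed.

(** The real and imaginary parts of [cexp h - 1 - h] are sums of six terms, each
    controlled by the derivatives at [0] of [expR], [cos] and [sin]. *)
Lemma cexp_sub1_small (e : R) : 0 < e -> exists2 r, 0 < r &
  forall h : R[i], normc h < r -> normc (cexp h - 1 - h) <= e * normc h.
Proof.
move=> e0.
(* Six error terms of size [d * |h|] have to fit into [e * |h|]. *)
pose d := Num.min (e / 6) 1.
have d0 : 0 < d by rewrite lt_min ltr01 divr_gt0.
have d1 : d <= 1 by rewrite ge_min lexx orbT.
have d6 : 6 * d <= e by rewrite mulrC -ler_pdivlMr// ge_min lexx.
have [r1 r10 h1] := is_derive_frechet (is_derive_expR 0) d0.
have [r2 r20 h2] := is_derive_frechet (is_derive_cos 0) d0.
have [r3 r30 h3] := is_derive_frechet (is_derive_sin 0) d0.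
exists (Num.min (d / 2) (Num.min r1 (Num.min r2 r3))).
  by rewrite !lt_min r10 r20 r30 divr_gt0.
move=> [x y]; rewrite !lt_min => /and4P[hd hr1 hr2 hr3].
set H := normc (x +i* y) in hd hr1 hr2 hr3 *.
have xH : `|x| <= H := normc_Re (x +i* y).
have yH : `|y| <= H := normc_Im (x +i* y).
have {}h1 := h1 x (le_lt_trans xH hr1).
have {}h2 := h2 y (le_lt_trans yH hr2).
have {}h3 := h3 y (le_lt_trans yH hr3).
rewrite !add0r expR0 mul1r in h1.
rewrite !add0r cos0 sin0 oppr0 mul0r subr0 in h2.
rewrite !add0r cos0 sin0 subr0 mul1r in h3.
have H0 : 0 <= H by exact: normc_ge0.
apply: le_trans (normc_le_ReIm _) _.
rewrite [complex.Re _](_ : _ = (expR x - 1 - x) + expR x * (cos y - 1)); last first.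
  by rewrite !ReB Re_cexp /=; ring.
rewrite [complex.Im _](_ : _ = (expR x - 1) * sin y + (sin y - y)); last first.
  by rewrite !ImB Im_cexp /=; ring.
have dH a b : `|a| <= d * `|b| -> `|b| <= H -> `|a| <= d * H.
  by move=> ab bH; apply: le_trans ab _; rewrite ler_wpM2l// ltW.
move: h1 h2 h3 => /dH/(_ xH) h1 /dH/(_ yH) h2 /dH/(_ yH) h3.
have eB : `|expR x - 1| <= d.
  rewrite (_ : expR x - 1 = (expR x - 1 - x) + x); last by ring.
  apply: le_trans (ler_normD _ _) _.
  apply: le_trans (lerD h1 xH) _.
  rewrite -[leRHS]mulr1 (_ : 1 = 2^-1 + 2^-1 :> R); last by field.
  rewrite mulrDr lerD//; last exact: ltW.
  by rewrite ler_wpM2l//; lra.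
have e2 : `|expR x| <= 2.
  by rewrite -[expR x](subrK 1) (le_trans (ler_normD _ _))// normr1; lra.
have s1 : `|sin y| <= H + H.
  rewrite -[sin y](subrK y) (le_trans (ler_normD _ _))//.
  by rewrite lerD// (le_trans h3)// ler_piMl.
have := lerD (ler_normD (expR x - 1 - x) (expR x * (cos y - 1)))
  (ler_normD ((expR x - 1) * sin y) (sin y - y)).
move=> /le_trans; apply; rewrite !normrM.
have t1 : `|expR x| * `|cos y - 1| <= 2 * (d * H) by rewrite ler_pM.
have t2 : `|expR x - 1| * `|sin y| <= d * (H + H) by rewrite ler_pM.
have t3 : 6 * d * H <= e * H by rewrite ler_wpM2r.
by lra.
Qed.

Lemma cderiv_cexp z : cderiv (@cexp R) z (cexp z).
Proof.
move=> e e0; have E0 := expR_gt0 (complex.Re z).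
have [r r0 rP] := cexp_sub1_small (divr_gt0 e0 E0).
exists r => // h /rP H; rewrite cexpD.
rewrite (_ : _ - _ - _ = cexp z * (cexp h - 1 - h)); last by ring.
rewrite normcM normc_cexp mulrC -ler_pdivlMr//.
by rewrite mulrAC.
Qed.

Lemma derivable_cexp z : derivable (@cexp R : R[i]^o -> R[i]^o) z 1.
Proof. by apply/derivable_cderivP; exists (cexp z); exact: cderiv_cexp. Qed.

End ComplexExponential.

Section ComplexLogarithm.
Variable R : realType.
Implicit Types z w : R[i].

Lemma rcontP (u : R[i] -> R) z :
  {for z, continuous (u : R[i]^o -> R)} <->
  forall e, 0 < e -> exists2 r, 0 < r &
    forall w, normc (w - z) < r -> `|u w - u z| < e.
Proof.
split=> [cu e e0|cu A /nbhs_ballP[e /= e0 eA]].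
  have /cu /nbhs_cP // : nbhs (u z) [set x | `|x - u z| < e].
  by apply/nbhs_ballP; exists e => //= y; rewrite /ball/= distrC.
have [r r0 rP] := cu _ e0; apply/nbhs_cP; exists r => // w /rP H; apply: eA.
by rewrite /ball/= distrC.
Qed.

Lemma Re_continuous : continuous (@complex.Re R : R[i]^o -> R).
Proof.
move=> z; apply/rcontP => e e0; exists e => // w; apply: le_lt_trans.
by rewrite -ReB normc_Re.
Qed.

Lemma Im_continuous : continuous (@complex.Im R : R[i]^o -> R).
Proof.
move=> z; apply/rcontP => e e0; exists e => // w; apply: le_lt_trans.
by rewrite -ImB normc_Im.
Qed.

Lemma normc_dist z w : `|normc w - normc z| <= normc (w - z).
Proof. by rewrite -lecR -!normcK -normc_real -normcK rmorphB/= -!normcK ler_dist_dist. Qed.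

Lemma normc_continuous : continuous (@ComplexField.Normc.normc R : R[i]^o -> R).
Proof.
move=> z; apply/rcontP => e e0; exists e => // w; apply: le_lt_trans.
exact: normc_dist.
Qed.

Lemma ccont_ReIm (f : R[i] -> R[i]) z :
  {for z, continuous ((fun w => complex.Re (f w)) : R[i]^o -> R)} ->
  {for z, continuous ((fun w => complex.Im (f w)) : R[i]^o -> R)} -> ccont f z.
Proof.
move=> /rcontP cR /rcontP cI e e0.
have e20 : 0 < e / 2 by rewrite divr_gt0.
have [r1 r10 h1] := cR _ e20; have [r2 r20 h2] := cI _ e20.
exists (Num.min r1 r2); first by rewrite lt_min r10.
move=> w; rewrite lt_min => /andP[/h1 {}h1 /h2 {}h2].
apply: le_lt_trans (normc_le_ReIm _) _; rewrite ReB ImB (splitr e).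
exact: ltrD.
Qed.

(** The principal logarithm where the real part is positive; there [atan] gives
    the argument. *)
Definition clog w : R[i] := ln (normc w) +i* atan (complex.Im w / complex.Re w).

Lemma cexp_clog w : 0 < complex.Re w -> cexp (clog w) = w.
Proof.
move=> w0; set t := complex.Im w / complex.Re w.
have nw0 : 0 < normc w.
  by rewrite (lt_le_trans _ (normc_Re w))// normr_gt0 gt_eqF.
have c0 : 0 < cos (atan t).
  by rewrite cos_gt0_pihalf// atan_gtNpi2 atan_ltpi2.
have sE : sin (atan t) = t * cos (atan t).
  by rewrite -{2}[t]atanK /tan divfK// gt_eqF.
have cE : normc w * cos (atan t) = complex.Re w.
  apply/eqP; rewrite -(eqrXn2 (n := 2))// ?ltW// ?mulr_gt0//.
  rewrite exprMn sqr_normcE.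
  have -> : complex.Im w = t * complex.Re w by rewrite divfK// gt_eqF.
  have : cos (atan t) ^+ 2 + sin (atan t) ^+ 2 = 1 by rewrite cos2Dsin2.
  rewrite sE => H; apply/eqP.
  by rewrite -[RHS]mulr1 -H; ring.
rewrite /cexp /clog /= lnK ?posrE// sE; simpc; rewrite mulrCA cE.
by rewrite /t divfK ?gt_eqF//; case: (w).
Qed.

Lemma clog_cont w : 0 < complex.Re w -> ccont clog w.
Proof.
move=> w0; apply: ccont_ReIm => /=.
  apply: (@continuous_comp _ _ _ (@ComplexField.Normc.normc R : R[i]^o -> R) (@ln R)).
    exact: normc_continuous.
  by apply: continuous_ln; rewrite (lt_le_trans _ (normc_Re w))// normr_gt0 gt_eqF.
apply: (@continuous_comp _ _ _
  (fun x : R[i]^o => complex.Im x / complex.Re x : R) (@atan R)).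
  apply: (@continuousM _ _ (@complex.Im R : R[i]^o -> R)
    (fun x : R[i]^o => (complex.Re x)^-1 : R)); first exact: Im_continuous.
  by apply: continuousV; [rewrite gt_eqF|exact: Re_continuous].
exact: continuous_atan.
Qed.

(** The increment [D] of [l] is small by continuity, and [cexp D - 1 = h / w];
    since [cexp D - 1 = D + o(D)], this gives [D = h / w + o(h)]. *)
Lemma cderiv_log (l : R[i] -> R[i]) w : ccont l w ->
  (exists2 r, 0 < r & forall v, normc (v - w) < r -> cexp (l v) = v) ->
  cderiv l w w^-1.
Proof.
move=> cl [r r0 rP] e e0.
have w0 : 0 < normc w.
  by rewrite normc_gt0 -[w]rP ?cexp_neq0// subrr normc0.
have e10 : 0 < Num.min 2^-1 (e * normc w / 2).
  by rewrite lt_min invr_gt0 ltr0n/= !mulr_gt0.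
have [r1 r10 h1] := cexp_sub1_small e10.
have [r2 r20 h2] := cl _ r10.
exists (Num.min r r2); first by rewrite lt_min r0.
move=> h; rewrite lt_min => /andP[hr hr2].
have hw : w + h - w = h by rewrite addrC addKr.
have lw : cexp (l w) = w by rewrite rP// subrr normc0.
have lwh : cexp (l (w + h)) = w + h by rewrite rP// hw.
set D := l (w + h) - l w.
have {}h2 : normc D < r1 by rewrite h2// hw.
have wne : w != 0 by rewrite -normc_gt0.
have ED : cexp D - 1 = h / w.
  by rewrite cexpD cexpN lw lwh; field.
have {h1} := h1 _ h2; rewrite ED.
rewrite normcB_sym (mulrC w^-1) => H.
have D2 : normc D <= 2 * (normc h / normc w).
  have : normc D <= normc (D - h / w) + normc (h / w).
    by apply: le_trans (normcD _ _); rewrite subrK.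
  have : Num.min 2^-1 (e * normc w / 2) * normc D <= 2^-1 * normc D.
    by rewrite ler_wpM2r ?normc_ge0// ge_min lexx.
  by rewrite [normc (h / w)]normcM normcV; lra.
apply: le_trans H _.
have : Num.min 2^-1 (e * normc w / 2) * normc D <= (e * normc w / 2) * (2 * (normc h / normc w)).
  by rewrite ler_pM ?normc_ge0// ?ge_min ?lexx ?orbT// ltW.
move=> /le_trans; apply; rewrite le_eqVlt; apply/orP; left; apply/eqP.
by field; rewrite gt_eqF.
Qed.

Lemma derivable_clog w : 0 < complex.Re w ->
  derivable (clog : R[i]^o -> R[i]^o) w 1.
Proof.
move=> w0; apply/derivable_cderivP; exists w^-1; apply: cderiv_log.
  exact: clog_cont.
exists (complex.Re w) => // v vw; apply: cexp_clog.
have := le_lt_trans (normc_Re _) vw; rewrite ReB ltr_norml => /andP[+ _].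
by lra.
Qed.

(** In terms of [v = cexp w], this says that [v ^ s] has derivative [s] at
    [v = 1]. *)
Lemma cexp_scale_sub1 (s e : R) : 0 < e -> exists2 r, 0 < r &
  forall w : R[i], normc w < r ->
    normc (cexp (s%:C * w) - 1 - s%:C * (cexp w - 1)) <= e * normc (cexp w - 1).
Proof.
move=> e0.
have s0 : 0 < `|s| + 1 by rewrite ltr_wpDl.
pose d := Num.min 2^-1 (e / (4 * (`|s| + 1))).
have d0 : 0 < d by rewrite lt_min invr_gt0 ltr0n/= divr_gt0// mulr_gt0.
have [r r0 rP] := cexp_sub1_small d0.
exists (r / (`|s| + 1)); first by rewrite divr_gt0.
move=> w wr.
have wr1 : normc w < r.
  rewrite (lt_le_trans wr)// ler_pdivrMr//.
  by have := normr_ge0 s; nra.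
have swr : normc (s%:C * w) < r.
  rewrite normcM normc_real mulrC; rewrite ltr_pdivlMr// in wr.
  by apply: le_lt_trans wr; rewrite ler_wpM2l ?normc_ge0// lerDl.
have H1 := rP _ wr1; have H2 := rP _ swr.
(* Replacing [|w|] by [|cexp w - 1|] costs a factor [2]. *)
have w2 : normc w <= 2 * normc (cexp w - 1).
  have : normc w <= normc (cexp w - 1 - w) + normc (cexp w - 1).
    by rewrite normcB_sym (le_trans _ (normcD _ _))// subrK.
  have : d * normc w <= 2^-1 * normc w by rewrite ler_wpM2r ?normc_ge0// ge_min lexx.
  by lra.
rewrite (_ : _ - _ - _ =
  (cexp (s%:C * w) - 1 - s%:C * w) - s%:C * (cexp w - 1 - w)); last by ring.
apply: le_trans (normcD _ _) _; rewrite normcN.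
move: H2; rewrite !normcM !normc_real => H2.
apply: le_trans (lerD H2 (ler_wpM2l (normr_ge0 s) H1)) _.
have -> : d * (`|s| * normc w) + `|s| * (d * normc w) = 2 * d * `|s| * normc w by ring.
apply: le_trans (ler_wpM2l _ w2) _; first by rewrite !mulr_ge0// ltW.
rewrite mulrA ler_wpM2r ?normc_ge0//.
have -> : 2 * d * `|s| * 2 = d * (4 * `|s|) by ring.
have : d * (4 * (`|s| + 1)) <= e.
  by rewrite -ler_pdivlMr ?mulr_gt0// ge_min lexx orbT.
by apply: le_trans; rewrite ler_wpM2l// ?ltW//; lra.
Qed.

End ComplexLogarithm.

(** * Goursat's lemma for real closed forms *)

Section SegmentIntegral.
Variable R : realType.
Notation mu := (@lebesgue_measure R).
Implicit Types (f g : R -> R) (a b : R).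

(** For [b < a] the segment is empty and the integral is [0]. *)
Definition sint f a b : R := \int[mu]_(t in `[a, b]) f t.

Definition seg_cont f a b := forall t, a <= t <= b -> {for t, continuous f}.

Lemma sub_seg_cont f a b a' b' : a <= a' -> b' <= b ->
  seg_cont f a b -> seg_cont f a' b'.
Proof.
move=> aa bb cf t /andP[at' tb']; apply: cf.
by rewrite (le_trans aa)// (le_trans tb').
Qed.

Lemma seg_contB f g a b : seg_cont f a b -> seg_cont g a b ->
  seg_cont (fun t => f t - g t) a b.
Proof. by move=> cf cg t tab; apply: continuousB; [exact: cf|exact: cg]. Qed.

Lemma seg_cont_cst c a b : seg_cont (fun=> c) a b.
Proof. by move=> t _; exact: cst_continuous. Qed.

Lemma seg_cont_integrable f a b : seg_cont f a b ->
  mu.-integrable `[a, b] (EFin \o f).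
Proof.
move=> cf; apply: continuous_compact_integrable; first exact: segment_compact.
by apply: continuous_in_subspaceT => t; rewrite inE/= in_itv/=; exact: cf.
Qed.

Lemma sintB f g a b : seg_cont f a b -> seg_cont g a b ->
  sint (fun t => f t - g t) a b = sint f a b - sint g a b.
Proof. by move=> cf cg; rewrite /sint RintegralB//; exact: seg_cont_integrable. Qed.

Lemma sint_cst c a b : a <= b -> sint (fun=> c) a b = c * (b - a).
Proof.
move=> ab; rewrite /sint Rintegral_cst//= lebesgue_measure_itv/= lte_fin.
by case: ltgtP ab => //= ->; rewrite subrr.
Qed.

Lemma sint_split f a c b : a <= c -> c <= b -> seg_cont f a b ->
  sint f a b = sint f a c + sint f c b.
Proof.
move=> ac cb cf; apply/eqP; rewrite addrC -subr_eq; apply/eqP.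
rewrite /sint Rintegral_itvB ?bnd_simp//; last exact: seg_cont_integrable.
rewrite Rintegral_itv_obnd_cbnd//.
apply: integrableS (seg_cont_integrable (sub_seg_cont ac (lexx b) cf)) => //.
exact: subset_itv_oc_cc.
Qed.

Lemma sint_near f c M a b : a <= b -> seg_cont f a b ->
  (forall t, a <= t <= b -> `|f t - c| <= M) ->
  `|sint f a b - c * (b - a)| <= M * (b - a).
Proof.
move=> ab cf fM; rewrite -sint_cst// -sintB//; last exact: seg_cont_cst.
have ci : seg_cont (fun t => f t - c) a b by apply: seg_contB => //; exact: seg_cont_cst.
rewrite /sint (le_trans (le_normr_Rintegral _ _))//; first exact: seg_cont_integrable.
rewrite -sint_cst// /sint le_Rintegral//.
- by apply/integrable_norm => //; exact: seg_cont_integrable.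
- by apply: seg_cont_integrable; exact: seg_cont_cst.
Qed.

End SegmentIntegral.

Section RectangleIntegral.
Variable R : realType.
Implicit Types (P Q : R -> R -> R).

(** [(a, b)] is the gradient of [P] at [(x, y)], in the Frechet sense. *)
Definition grad P (x y a b : R) := forall e, 0 < e -> exists2 r, 0 < r &
  forall h k, `|h| < r -> `|k| < r ->
    `|P (x + h) (y + k) - P x y - (a * h + b * k)| <= e * (`|h| + `|k|).

(** [P dx + Q dy] is differentiable at the point with equal cross derivatives; the
    derivatives are not required to be continuous. *)
Definition closed_form P Q (x y : R) :=
  exists a b c, grad P x y a b /\ grad Q x y b c.

Definition in_rect (x0 x1 y0 y1 x y : R) := (x0 <= x <= x1) && (y0 <= y <= y1).

(** Counterclockwise integral of [P dx + Q dy] along the boundary of the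
    rectangle. *)
Definition rect_int P Q (x0 x1 y0 y1 : R) : R :=
  sint (fun t => P t y0 - P t y1) x0 x1 + sint (fun t => Q x1 t - Q x0 t) y0 y1.

Lemma eps_continuous (f : R -> R) x :
  (forall e, 0 < e -> exists2 r, 0 < r &
    forall h, `|h| < r -> `|f (x + h) - f x| < e) -> {for x, continuous f}.
Proof.
move=> cf A /nbhs_ballP[e /= e0 eA]; have [r r0 rP] := cf _ e0.
apply/nbhs_ballP; exists r => //= t; rewrite /ball/= distrC => tr.
by apply: eA; rewrite /ball/= distrC; have := rP _ tr; rewrite [x + _]addrC subrK.
Qed.

Lemma grad_lipschitz P x y a b : grad P x y a b ->
  forall e, 0 < e -> exists2 r, 0 < r & forall h k, `|h| < r -> `|k| < r ->
    `|P (x + h) (y + k) - P x y| < e.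
Proof.
move=> gP e e0; have [r r0 rP] := gP _ (ltr01 : 0 < 1 :> R).
have M0 : 0 < `|a| + `|b| + 2 by rewrite ltr_wpDl// addr_ge0.
exists (Num.min r (e / (`|a| + `|b| + 2))); first by rewrite lt_min r0 divr_gt0.
move=> h k; rewrite !lt_min => /andP[hr he] /andP[kr ke].
have := rP h k hr kr; rewrite mul1r => H.
rewrite -[X in `|X|](subrK (a * h + b * k)).
apply: le_lt_trans (ler_normD _ _) _; apply: le_lt_trans (lerD H (ler_normD _ _)) _.
rewrite !normrM; rewrite !ltr_pdivlMr// in he ke.
have Dh := normr_ge0 h; have Dk := normr_ge0 k.
have Da := normr_ge0 a; have Db := normr_ge0 b.
have [hk|/ltW hk] := leP `|h| `|k|; first by nra.
by nra.
Qed.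

Lemma grad_cont_l P x y a b : grad P x y a b -> {for x, continuous (fun t => P t y)}.
Proof.
move=> gP; apply: eps_continuous => e /(grad_lipschitz gP)[r r0 rP].
by exists r => // h hr; have := rP h 0 hr; rewrite normr0 addr0; exact.
Qed.

Lemma grad_cont_r P x y a b : grad P x y a b -> {for y, continuous (P x)}.
Proof.
move=> gP; apply: eps_continuous => e /(grad_lipschitz gP)[r r0 rP].
by exists r => // h hr; have := rP 0 h; rewrite normr0 addr0; exact.
Qed.

Section Bisection.
Variables (P Q : R -> R -> R).

Let closed_on x0 x1 y0 y1 :=
  forall x y, in_rect x0 x1 y0 y1 x y -> closed_form P Q x y.

Lemma closed_seg_contP x0 x1 y0 y1 y : closed_on x0 x1 y0 y1 ->
  y0 <= y <= y1 -> seg_cont (fun t => P t y) x0 x1.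
Proof.
move=> cPQ yy t tt; have [|a [b [c [gP _]]]] := cPQ t y; first by rewrite /in_rect tt.
exact: grad_cont_l gP.
Qed.

Lemma closed_seg_contQ x0 x1 y0 y1 x : closed_on x0 x1 y0 y1 ->
  x0 <= x <= x1 -> seg_cont (Q x) y0 y1.
Proof.
move=> cPQ xx t tt; have [|a [b [c [_ gQ]]]] := cPQ x t; first by rewrite /in_rect xx.
exact: grad_cont_r gQ.
Qed.

Lemma rect_int_split_x x0 x x1 y0 y1 : x0 <= x -> x <= x1 -> y0 <= y1 ->
  closed_on x0 x1 y0 y1 ->
  rect_int P Q x0 x1 y0 y1 = rect_int P Q x0 x y0 y1 + rect_int P Q x x1 y0 y1.
Proof.
move=> x0x xx1 yy cPQ; have xx := le_trans x0x xx1.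
have c0 := closed_seg_contP cPQ (y := y0); have c1 := closed_seg_contP cPQ (y := y1).
have d0 := closed_seg_contQ cPQ (x := x0); have d1 := closed_seg_contQ cPQ (x := x1).
have d := closed_seg_contQ cPQ (x := x).
rewrite lexx in c0; rewrite lexx andbT in c1.
rewrite lexx in d0; rewrite lexx andbT in d1; rewrite x0x in d.
rewrite /rect_int (sint_split x0x xx1); last first.
  by apply: seg_contB; [exact: c0|exact: c1].
rewrite !(sintB (f := Q _)); try by [exact: d0|exact: d1|exact: d].
by ring.
Qed.

Lemma rect_int_split_y x0 x1 y0 y y1 : y0 <= y -> y <= y1 -> x0 <= x1 ->
  closed_on x0 x1 y0 y1 ->
  rect_int P Q x0 x1 y0 y1 = rect_int P Q x0 x1 y0 y + rect_int P Q x0 x1 y y1.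
Proof.
move=> y0y yy1 xx cPQ; have yy := le_trans y0y yy1.
have c0 := closed_seg_contP cPQ (y := y0); have c1 := closed_seg_contP cPQ (y := y1).
have c := closed_seg_contP cPQ (y := y).
have d0 := closed_seg_contQ cPQ (x := x0); have d1 := closed_seg_contQ cPQ (x := x1).
rewrite lexx in c0; rewrite lexx andbT in c1; rewrite y0y in c.
rewrite lexx in d0; rewrite lexx andbT in d1.
rewrite /rect_int (sint_split y0y yy1); last first.
  by apply: seg_contB; [exact: d1|exact: d0].
rewrite !(sintB (f := P ^~ _)); try by [exact: c0|exact: c1|exact: c].
by ring.
Qed.

(** On a small rectangle the linear parts of [P] and [Q] contribute
    [(b - b) * area], so only the remainders survive. *)
Lemma rect_int_small x y e : closed_form P Q x y -> 0 < e ->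
  exists2 r, 0 < r & forall x0 x1 y0 y1, in_rect x0 x1 y0 y1 x y ->
    closed_on x0 x1 y0 y1 -> x1 - x0 < r -> y1 - y0 < r ->
    `|rect_int P Q x0 x1 y0 y1| <= 2 * e * (x1 - x0 + (y1 - y0)) ^+ 2.
Proof.
move=> [a [b [c [gP gQ]]]] e0.
have [r1 r10 P1] := gP _ e0; have [r2 r20 Q1] := gQ _ e0.
exists (Num.min r1 r2); first by rewrite lt_min r10.
move=> x0 x1 y0 y1 /andP[/andP[x0x xx1] /andP[y0y yy1]] cPQ.
rewrite !lt_min => /andP[xr1 xr2] /andP[yr1 yr2].
have xx := le_trans x0x xx1; have yy := le_trans y0y yy1.
set w := x1 - x0 in xr1 xr2 *; set k := y1 - y0 in yr1 yr2 *.
have near (z z0 z1 t : R) : z0 <= z -> z <= z1 -> z0 <= t <= z1 -> `|t - z| <= z1 - z0.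
  by move=> ? ? /andP[? ?]; rewrite ler_norml; apply/andP; split; lra.
have boundP s t : x0 <= s <= x1 -> y0 <= t <= y1 ->
    `|P s t - P x y - (a * (s - x) + b * (t - y))| <= e * (w + k).
  move=> sx ty; have sn := near _ _ _ _ x0x xx1 sx; have tn := near _ _ _ _ y0y yy1 ty.
  have := P1 (s - x) (t - y); rewrite (addrC x) (addrC y) !subrK.
  move=> /(_ (le_lt_trans sn xr1) (le_lt_trans tn yr1)) /le_trans; apply.
  by apply: (ler_wpM2l (ltW e0)); rewrite lerD.
have boundQ s t : x0 <= s <= x1 -> y0 <= t <= y1 ->
    `|Q s t - Q x y - (b * (s - x) + c * (t - y))| <= e * (w + k).
  move=> sx ty; have sn := near _ _ _ _ x0x xx1 sx; have tn := near _ _ _ _ y0y yy1 ty.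
  have := Q1 (s - x) (t - y); rewrite (addrC x) (addrC y) !subrK.
  move=> /(_ (le_lt_trans sn xr2) (le_lt_trans tn yr2)) /le_trans; apply.
  by apply: (ler_wpM2l (ltW e0)); rewrite lerD.
have h0 : y0 <= y0 <= y1 by rewrite lexx.
have h1 : y0 <= y1 <= y1 by rewrite lexx andbT.
have v0 : x0 <= x0 <= x1 by rewrite lexx.
have v1 : x0 <= x1 <= x1 by rewrite lexx andbT.
have HP : `|sint (fun t => P t y0 - P t y1) x0 x1 - (- b * k) * w| <= 2 * e * (w + k) * w.
  apply: sint_near => //.
    by apply: seg_contB; [exact: closed_seg_contP h0|exact: closed_seg_contP h1].
  move=> t tx; have := lerD (boundP t y0 tx h0) (boundP t y1 tx h1).
  move/(le_trans (ler_normB _ _)) => H.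
  rewrite (_ : 2 * e * (w + k) = e * (w + k) + e * (w + k)); last by ring.
  by apply: le_trans H; rewrite le_eqVlt; apply/orP; left; apply/eqP; congr `|_|; rewrite /k; ring.
have HQ : `|sint (fun t => Q x1 t - Q x0 t) y0 y1 - (b * w) * k| <= 2 * e * (w + k) * k.
  apply: sint_near => //.
    by apply: seg_contB; [exact: closed_seg_contQ v1|exact: closed_seg_contQ v0].
  move=> t tx; have := lerD (boundQ x1 t v1 tx) (boundQ x0 t v0 tx).
  move/(le_trans (ler_normB _ _)) => H.
  rewrite (_ : 2 * e * (w + k) = e * (w + k) + e * (w + k)); last by ring.
  by apply: le_trans H; rewrite le_eqVlt; apply/orP; left; apply/eqP; congr `|_|; rewrite /w; ring.
have := le_trans (ler_normD _ _) (lerD HP HQ).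
rewrite [X in `|X| <= _](_ : _ = rect_int P Q x0 x1 y0 y1); last by rewrite /rect_int; ring.
by move=> /le_trans; apply; rewrite le_eqVlt; apply/orP; left; apply/eqP; ring.
Qed.

End Bisection.

End RectangleIntegral.

Section Goursat.
Variable R : realType.
Variables (P Q : R -> R -> R).

Lemma sub_in_rect (x0 x1 y0 y1 a0 a1 b0 b1 x y : R) :
  x0 <= a0 -> a1 <= x1 -> y0 <= b0 -> b1 <= y1 ->
  in_rect a0 a1 b0 b1 x y -> in_rect x0 x1 y0 y1 x y.
Proof.
move=> ? ? ? ? /andP[/andP[? ?] /andP[? ?]].
by apply/andP; split; apply/andP; split; lra.
Qed.

(** One of the four quarters carries at least a quarter of the integral. *)
Lemma rect_int_quarter (x0 y0 w h : R) : 0 <= w -> 0 <= h ->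
  (forall x y, in_rect x0 (x0 + (w + w)) y0 (y0 + (h + h)) x y -> closed_form P Q x y) ->
  exists p : R * R,
    [/\ x0 <= p.1, p.1 <= x0 + w, y0 <= p.2, p.2 <= y0 + h &
        `|rect_int P Q x0 (x0 + (w + w)) y0 (y0 + (h + h))| <=
        4 * `|rect_int P Q p.1 (p.1 + w) p.2 (p.2 + h)|].
Proof.
move=> w0 h0 cPQ.
have xw : x0 <= x0 + w by lra.
have xw2 : x0 + w <= x0 + (w + w) by lra.
have yh : y0 <= y0 + h by lra.
have yh2 : y0 + h <= y0 + (h + h) by lra.
have yy := le_trans yh yh2.
rewrite (rect_int_split_x xw xw2 yy cPQ).
rewrite (rect_int_split_y yh yh2 xw); last first.
  by move=> x y /(sub_in_rect (lexx _) xw2 (lexx _) (lexx _)); exact: cPQ.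
rewrite (rect_int_split_y yh yh2 xw2); last first.
  by move=> x y /(sub_in_rect xw (lexx _) (lexx _) (lexx _)); exact: cPQ.
rewrite addrA.
set A := rect_int P Q x0 (x0 + w) y0 (y0 + h).
set B := rect_int P Q x0 (x0 + w) (y0 + h) (y0 + (h + h)).
set C := rect_int P Q (x0 + w) (x0 + (w + w)) y0 (y0 + h).
set D := rect_int P Q (x0 + w) (x0 + (w + w)) (y0 + h) (y0 + (h + h)).
have tri : `|A + B + C + D| <= `|A| + `|B| + `|C| + `|D|.
  do 2 (apply: le_trans (ler_normD _ _) _; rewrite lerD2r).
  exact: ler_normD.
set S := `|A + B + C + D| in tri *.
have [HA|HA] := leP S (4 * `|A|); first by exists (x0, y0).
have [HB|HB] := leP S (4 * `|B|).
  by exists (x0, y0 + h) => /=; split => //; rewrite -addrA.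
have [HC|HC] := leP S (4 * `|C|).
  by exists (x0 + w, y0) => /=; split => //; rewrite -addrA.
exists (x0 + w, y0 + h) => /=; split => //.
by rewrite -!addrA -/D; lra.
Qed.

(** Goursat's argument: repeated bisection yields nested rectangles whose
    boundary integrals decay no faster than their areas, while differentiability
    at the common point makes them negligible compared to the areas. *)
Lemma goursat (x0 x1 y0 y1 : R) : x0 <= x1 -> y0 <= y1 ->
  (forall x y, in_rect x0 x1 y0 y1 x y -> closed_form P Q x y) ->
  rect_int P Q x0 x1 y0 y1 = 0.
Proof.
move=> xx yy cPQ; set E0 := rect_int _ _ _ _ _ _.
pose w n : R := (x1 - x0) / 2 ^+ n; pose h n : R := (y1 - y0) / 2 ^+ n.
have w0 n : 0 <= w n by rewrite divr_ge0 ?subr_ge0 ?exprn_ge0.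
have h0 n : 0 <= h n by rewrite divr_ge0 ?subr_ge0 ?exprn_ge0.
have half (a : R) n : a / 2 ^+ n = a / 2 ^+ n.+1 + a / 2 ^+ n.+1.
  by rewrite exprS; field; rewrite expf_neq0.
have wS n : w n = w n.+1 + w n.+1 by exact: half.
have hS n : h n = h n.+1 + h n.+1 by exact: half.
pose E (p : R * R) n := rect_int P Q p.1 (p.1 + w n) p.2 (p.2 + h n).
pose inside (p : R * R) n := [/\ x0 <= p.1, p.1 + w n <= x1, y0 <= p.2 & p.2 + h n <= y1].
have /choice[F FP] : forall q : nat * (R * R), exists p : R * R, inside q.2 q.1 ->
    [/\ q.2.1 <= p.1, p.1 <= q.2.1 + w q.1.+1, q.2.2 <= p.2, p.2 <= q.2.2 + h q.1.+1 &
        `|E q.2 q.1| <= 4 * `|E p q.1.+1|].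
  move=> [n [x y]] /=.
  have [[/= a1 a2 a3 a4]|ni] := pselect (inside (x, y) n); last by exists (x, y).
  rewrite /E /= (wS n) (hS n); rewrite (wS n) in a2; rewrite (hS n) in a4.
  have cq s t : in_rect x (x + (w n.+1 + w n.+1)) y (y + (h n.+1 + h n.+1)) s t ->
      closed_form P Q s t.
    by move=> /(sub_in_rect a1 a2 a3 a4); exact: cPQ.
  by have [p pP] := rect_int_quarter (w0 _) (h0 _) cq; exists p.
pose fix pt n : R * R := if n is m.+1 then F (m, pt m) else (x0, y0).
have pin n : inside (pt n) n.
  elim: n => [|n IH]; first by rewrite /inside /w /h /= expr0 !divr1 !subrKC !lexx.
  have [a1 a2 a3 a4 _] := FP (n, pt n) IH.
  have := wS n; have := hS n; case: IH => /= b1 b2 b3 b4.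
  by rewrite /inside /= in a1 a2 a3 a4 *; split; lra.
have pstep n := FP (n, pt n) (pin n).
have mono n m : (n <= m)%N ->
    [/\ (pt n).1 <= (pt m).1, (pt m).1 + w m <= (pt n).1 + w n,
        (pt n).2 <= (pt m).2 & (pt m).2 + h m <= (pt n).2 + h n].
  elim: m => [|m IH]; first by rewrite leqn0 => /eqP ->.
  rewrite leq_eqVlt => /predU1P[->//|]; rewrite ltnS => /IH[b1 b2 b3 b4].
  have [/= a1 a2 a3 a4 _] := pstep m; have := wS m; have := hS m.
  by move=> ? ?; split; lra.
have cross n m : (pt n).1 <= (pt m).1 + w m /\ (pt n).2 <= (pt m).2 + h m.
  have := w0 n; have := h0 n; have := w0 m; have := h0 m.
  by case: (leqP n m) => [|/ltnW] /mono[? ? ? ?] ? ? ? ?; split; lra.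
(* The lower left corners increase and the upper right corners decrease, so
   their common limit lies in all the rectangles. *)
pose xs := sup (range (fun n => (pt n).1)); pose ys := sup (range (fun n => (pt n).2)).
have xsP n : (pt n).1 <= xs <= (pt n).1 + w n.
  apply/andP; split.
    apply: ub_le_sup; last by exists n.
    by exists ((pt 0).1 + w 0) => _ [m _ <-]; have [] := cross m 0%N.
  by apply: ge_sup; [exists (pt 0).1; exists 0%N|move=> _ [m _ <-]; have [] := cross m n].
have ysP n : (pt n).2 <= ys <= (pt n).2 + h n.
  apply/andP; split.
    apply: ub_le_sup; last by exists n.
    by exists ((pt 0).2 + h 0) => _ [m _ <-]; have [] := cross m 0%N.
  by apply: ge_sup; [exists (pt 0).2; exists 0%N|move=> _ [m _ <-]; have [] := cross m n].
have Epow n : `|E0| <= 4 ^+ n * `|E (pt n) n|.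
  elim: n => [|n IH]; first by rewrite mul1r /E /w /h /= expr0 !divr1 !subrKC.
  have [_ _ _ _ H] := pstep n.
  by rewrite (le_trans IH)// exprSr -mulrA ler_wpM2l// exprn_ge0.
have cf : closed_form P Q xs ys.
  have := pin 0%N; rewrite /inside => -[b1 b2 b3 b4].
  by apply: cPQ; apply: sub_in_rect b1 b2 b3 b4 _; rewrite /in_rect xsP ysP.
set M := (x1 - x0 + (y1 - y0)) ^+ 2.
(* [4 ^ n] times the area of the [n]-th rectangle does not depend on [n]. *)
have small e : 0 < e -> `|E0| <= 2 * e * M.
  move=> e0; have [r r0 rP] := rect_int_small cf e0.
  have [n nP] : exists n, (x1 - x0 + (y1 - y0)) / 2 ^+ n < r.
    have Z : (fun n => (x1 - x0 + (y1 - y0)) * 2^-1 ^+ n) @ \oo --> (0 : R).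
      by apply: cvg_geometric; rewrite ger0_norm// invf_lt1// ltr1n.
    move/cvgr0Pnorm_lt : Z => /(_ r r0)[N _ /(_ N (leqnn N))].
    by rewrite exprVn => /(le_lt_trans (ler_norm _)); exists N.
  have wh : w n + h n < r by rewrite /w /h -mulrDl.
  have [b1 b2 b3 b4] := pin n; have wn := w0 n; have hn := h0 n.
  have := rP (pt n).1 ((pt n).1 + w n) (pt n).2 ((pt n).2 + h n).
  have addK (a b : R) : a + b - a = b by ring.
  rewrite /in_rect xsP ysP !addK => /(_ isT) H.
  apply: le_trans (Epow n) _.
  rewrite mulrC -ler_pdivlMr ?exprn_gt0//.
  apply: le_trans (H _ _ _) _; try lra.
    by move=> x y /(sub_in_rect b1 b2 b3 b4); exact: cPQ.
  rewrite le_eqVlt; apply/orP; left; apply/eqP; rewrite /M /w /h.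
  have -> : (4 : R) ^+ n = 2 ^+ n * 2 ^+ n by rewrite -exprMn; congr (_ ^+ _); ring.
  by field; rewrite expf_neq0.
apply/eqP; rewrite -normr_le0; apply/ler_addgt0Pr => e e0; rewrite add0r.
have M0 : 0 <= M by exact: sqr_ge0.
have M1 : 0 < 2 * (M + 1) by rewrite mulr_gt0// ltr_wpDl.
apply: le_trans (small (e / (2 * (M + 1))) _) _; first by rewrite divr_gt0.
rewrite [leLHS](_ : _ = e * (M / (M + 1))); last first.
  by field; rewrite gt_eqF// ltr_wpDl.
by rewrite ler_piMr ?(ltW e0)// ler_pdivrMr ?mul1r ?lerDl// ltr_wpDl.
Qed.

End Goursat.

(** * Mean values on circles *)

Section MeanValue.
Variable R : realType.
Implicit Types (f : R[i] -> R[i]) (z w : R[i]).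

(** The Cauchy-Riemann equations say that [Im (f dw) = v dx + u dy] is closed. *)
Lemma closed_form_Im f (x y : R) d : cderiv f (x +i* y) d ->
  closed_form (fun s t => complex.Im (f (s +i* t)))
              (fun s t => complex.Re (f (s +i* t))) x y.
Proof.
case: d => a b fd; exists b, a, (- b); split => e e0.
all: have [r r0 rP] := fd _ e0.
all: exists (r / 2); first by rewrite divr_gt0.
all: move=> h k hr kr.
all: have hk : normc (h +i* k) <= `|h| + `|k| := normc_le_ReIm (h +i* k).
all: have hkr : normc (h +i* k) < r by rewrite (le_lt_trans hk)// (splitr r) ltrD.
all: apply: le_trans (le_trans (rP _ hkr) (ler_wpM2l (ltW e0) hk)).
- have -> : ((x + h) +i* (y + k)) = (x +i* y) + (h +i* k) by [].
  apply: le_trans (normc_Im _); rewrite !ImB /=.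
  by rewrite le_eqVlt; apply/orP; left; apply/eqP; congr `|_|; ring.
- have -> : ((x + h) +i* (y + k)) = (x +i* y) + (h +i* k) by [].
  apply: le_trans (normc_Re _); rewrite !ReB /=.
  by rewrite le_eqVlt; apply/orP; left; apply/eqP; congr `|_|; ring.
Qed.

Definition rotate (t : R) z : R[i] := cexp (0 +i* t) * z.

Lemma normc_rotate t z : normc (rotate t z) = normc z.
Proof. by rewrite normcM normc_cexp expR0 mul1r. Qed.

(** Mean value property on circles for functions holomorphic in a punctured
    disc: in logarithmic coordinates [z * cexp w] the circles become vertical
    segments of length [2 * pi], and by periodicity the horizontal sides of a
    rectangle cancel, so all circles centred at [0] have the same mean, which is
    the limit at [0]. *)
Lemma circle_mean f z (l : R[i]) : z != 0 ->
  (forall w, w != 0 -> normc w <= normc z ->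
     derivable (f : R[i]^o -> R[i]^o) w 1) ->
  (forall e, 0 < e -> exists2 r, 0 < r &
     forall w, w != 0 -> normc w < r -> normc (f w - l) < e) ->
  seg_cont (fun t => complex.Re (f (rotate t z))) 0 (pi *+ 2) /\
  sint (fun t => complex.Re (f (rotate t z))) 0 (pi *+ 2) =
  complex.Re l * (pi *+ 2).
Proof.
move=> z0 df fl; pose G w := f (cexp w * z).
have p2 : 0 < pi *+ 2 :> R by rewrite mulrn_wgt0// pi_gt0.
have dG (w : R[i]) : complex.Re w <= 0 -> exists d, cderiv G w d.
  move=> w0; apply/derivable_cderivP.
  apply: (@derivable_ccomp _ (fun w => cexp w * z) f).
    apply: (@derivableM _ _ (@cexp R : R[i]^o -> R[i]^o) (cst z : R[i]^o -> R[i]^o)).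
      exact: derivable_cexp.
    exact: derivable_cst.
  apply: df; first by rewrite mulf_neq0// cexp_neq0.
  by rewrite normcM normc_cexp ler_piMl ?normc_ge0// -expR0 ler_expR.
pose P s t := complex.Im (G (s +i* t)); pose Q s t := complex.Re (G (s +i* t)).
have cPQ x y : x <= 0 -> closed_form P Q x y.
  by move=> x0; have [|d dd] := dG (x +i* y); [|exact: closed_form_Im dd].
have cQ x : x <= 0 -> seg_cont (Q x) 0 (pi *+ 2).
  by move=> x0 t _; have [? [? [? [_ gQ]]]] := cPQ x t x0; exact: grad_cont_r gQ.
split; first exact: (cQ 0 (lexx 0)).
have per x : G (x +i* (pi *+ 2)) = G (x +i* 0).
  rewrite /G; have -> : x +i* (pi *+ 2) = (x +i* 0) + (0 +i* (pi *+ 2)) :> R[i].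
    by simpc.
  by rewrite cexp2pi.
(* The horizontal sides contribute [P t 0 - P t (2 * pi) = 0]. *)
have const x : x <= 0 -> sint (Q 0) 0 (pi *+ 2) = sint (Q x) 0 (pi *+ 2).
  move=> x0.
  have : rect_int P Q x 0 0 (pi *+ 2) = 0.
    by apply: goursat => // [|s t /andP[/andP[_ s0] _]]; [exact: ltW|exact: cPQ].
  rewrite /rect_int (_ : (fun t => P t 0 - P t (pi *+ 2)) = fun=> 0); last first.
    by apply/funext => t; rewrite /P per subrr.
  rewrite (sint_cst _ x0) mul0r add0r (sintB (cQ _ (lexx _)) (cQ _ x0)).
  by move=> /eqP; rewrite subr_eq0 => /eqP.
have -> : sint (fun t => complex.Re (f (rotate t z))) 0 (pi *+ 2) = sint (Q 0) 0 (pi *+ 2).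
  by [].
apply/eqP; rewrite -subr_eq0 -normr_le0; apply/ler_addgt0Pr => e e0; rewrite add0r.
have [r r0 rP] := fl _ (divr_gt0 e0 p2).
have nz : 0 < normc z by rewrite normc_gt0.
(* On the circle of radius [exp x * |z| < r], [f] is close to its limit. *)
pose x := Num.min 0 (ln (r / 2 / normc z)).
have x0 : x <= 0 by rewrite ge_min lexx.
rewrite (const _ x0) -[_ *+ 2 in X in _ - X]subr0.
apply: le_trans (@sint_near _ _ _ (e / (pi *+ 2)) _ _ (ltW p2) (cQ _ x0) _) _; last first.
  by rewrite subr0 divfK ?gt_eqF.
move=> t _; rewrite /Q -ReB (le_trans (normc_Re _))// ltW// rP//.
  by rewrite mulf_neq0// cexp_neq0.
rewrite normcM normc_cexp /= -ltr_pdivlMr//.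
apply: (@le_lt_trans _ _ (r / 2 / normc z)).
  rewrite -[leRHS]lnK ?posrE ?divr_gt0// ler_expR ge_min lexx orbT//.
by rewrite ltr_pM2r ?invr_gt0// ltr_pdivrMr// ltr_pMr// ltr1n.
Qed.

End MeanValue.

(** * Rotation invariance of plane measure *)

Section Invariance.
Variable R : realType.
Notation T := (measurableTypeR R).
Notation mu := (@lebesgue_measure R).
Notation mu2 := (mu \x mu)%E.

Lemma measurable_addr (c : R) : measurable_fun [set: T] ((fun x => x + c) : T -> T).
Proof. by apply: measurable_funD; [exact: measurable_id|exact: measurable_cst]. Qed.

Lemma lebesgue_shift (c : R) (A : set T) : measurable A ->
  mu [set x | A (x + c)] = mu A.
Proof.
move=> mA; apply/esym.
pose f : T -> T := fun x => x + c.
have mf : measurable_fun [set: T] f by exact: measurable_addr.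
pose mf_mixin := isMeasurableFun.Build _ _ _ _ _ mf.
pose F : {mfun T >-> T} := HB.pack f mf_mixin.
apply: (@lebesgue_measure_unique R (pushforward mu F)) => //= _ [[a b]] _ <-.
rewrite /pushforward /= (_ : _ @^-1` _ = `]a - c, b - c]%classic).
  rewrite !lebesgue_measure_itv/= !lte_fin ltrD2r.
  by case: ifP => // _; rewrite -!EFinB; congr (_%:E); ring.
by apply/seteqP; split=> x /=; rewrite !in_itv/= /f ltrBlDr lerBrDr.
Qed.

Definition shear_y (a : R) (u : T * T) : T * T := (u.1, u.2 + a * u.1).
Definition shear_x (a : R) (u : T * T) : T * T := (u.1 + a * u.2, u.2).

Lemma measurable_shear_y a : measurable_fun [set: T * T] (shear_y a).
Proof.
apply: measurable_fun_pair; first exact: measurable_fst.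
apply: measurable_funD; first exact: measurable_snd.
by apply: measurable_funM; [exact: measurable_cst|exact: measurable_fst].
Qed.

Lemma measurable_shear_x a : measurable_fun [set: T * T] (shear_x a).
Proof.
apply: measurable_fun_pair; last exact: measurable_snd.
apply: measurable_funD; first exact: measurable_fst.
by apply: measurable_funM; [exact: measurable_cst|exact: measurable_snd].
Qed.

Lemma mu2_shear_y a (A : set (T * T)) : measurable A ->
  mu2 (shear_y a @^-1` A) = mu2 A.
Proof.
move=> mA; rewrite /product_measure1; apply: eq_integral => x _ /=.
have mx : measurable (xsection A x) by exact: measurable_xsection.
by rewrite -(lebesgue_shift (a * x) mx).
Qed.

Lemma mu2_swapE (A : set (T * T)) : measurable A -> mu2 A = (mu \x^ mu)%E A.
Proof.
move=> mA; apply: product_measure_unique => // B C mB mC.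
exact: product_measure2E.
Qed.

Lemma mu2_shear_x a (A : set (T * T)) : measurable A ->
  mu2 (shear_x a @^-1` A) = mu2 A.
Proof.
move=> mA; have mpA : measurable (shear_x a @^-1` A).
  by rewrite -[X in measurable X]setTI; exact: measurable_shear_x.
rewrite (mu2_swapE mA) (mu2_swapE mpA) /product_measure2; apply: eq_integral => y _ /=.
have my : measurable (ysection A y) by exact: measurable_ysection.
by rewrite -(lebesgue_shift (a * y) my).
Qed.

Definition rot2 (c s : R) (u : T * T) : T * T :=
  (c * u.1 - s * u.2, s * u.1 + c * u.2).

Lemma measurable_rot2 c s : measurable_fun [set: T * T] (rot2 c s).
Proof.
apply: measurable_fun_pair.
- by apply: measurable_funB; apply: measurable_funM;
    [exact: measurable_cst|exact: measurable_fst|exact: measurable_cst|exact: measurable_snd].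
- by apply: measurable_funD; apply: measurable_funM;
    [exact: measurable_cst|exact: measurable_fst|exact: measurable_cst|exact: measurable_snd].
Qed.

(** A rotation of angle [t], [cos t <> -1], is a product of three shears; each
    shear translates the lines parallel to an axis. *)
Lemma mu2_rot2_shears c s (A : set (T * T)) : c ^+ 2 + s ^+ 2 = 1 -> 1 + c != 0 ->
  measurable A -> mu2 (rot2 c s @^-1` A) = mu2 A.
Proof.
move=> cs c1 mA; pose t := s / (1 + c).
have mp1 : measurable (shear_x (- t) @^-1` A).
  by rewrite -[X in measurable X]setTI; exact: measurable_shear_x.
have mp2 : measurable (shear_y s @^-1` (shear_x (- t) @^-1` A)).
  by rewrite -[X in measurable X]setTI; exact: measurable_shear_y.
rewrite -(mu2_shear_x (- t) mA) -(mu2_shear_y s mp1) -(mu2_shear_x (- t) mp2).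
congr mu2; apply/seteqP.
suff rE u : rot2 c s u = shear_x (- t) (shear_y s (shear_x (- t) u)).
  by split=> u /=; rewrite rE.
case: u => x y; rewrite /rot2 /shear_x /shear_y /=.
have st : s * t = 1 - c.
  have -> : s * t = s ^+ 2 / (1 + c) by rewrite /t expr2 mulrA.
  have -> : s ^+ 2 = (1 - c) * (1 + c).
    by rewrite -[LHS](addrK (c ^+ 2)) addrC (addrC (s ^+ 2)) cs; ring.
  by rewrite mulfK.
have tc : t * (1 + c) = s by rewrite /t divfK.
have e2 : y + s * (x + - t * y) = s * x + c * y.
  have -> : y + s * (x + - t * y) = s * x + (1 - s * t) * y by ring.
  by rewrite st; ring.
congr (_, _); last by rewrite e2.
rewrite e2 -tc.
have -> : x + - t * y + - t * (t * (1 + c) * x + c * y) =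
  (1 - (t * (1 + c)) * t) * x - t * (1 + c) * y by ring.
by rewrite tc st; ring.
Qed.

Lemma mu2_rot2 c s (A : set (T * T)) : c ^+ 2 + s ^+ 2 = 1 ->
  measurable A -> mu2 (rot2 c s @^-1` A) = mu2 A.
Proof.
move=> cs mA; have [c1|c1] := eqVneq (1 + c) 0; last exact: mu2_rot2_shears.
have cE : c = -1 by apply/eqP; rewrite -addr_eq0 addrC c1.
have s0 : s = 0.
  by apply/eqP; rewrite -sqrf_eq0; apply/eqP; move: cs; rewrite cE sqrrN expr1n; lra.
have i0 : (0 : R) ^+ 2 + 1 ^+ 2 = 1 by rewrite expr0n expr1n add0r.
have n0 : 1 + (0 : R) != 0 by rewrite addr0 oner_eq0.
have mp : measurable (rot2 0 1 @^-1` A).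
  by rewrite -[X in measurable X]setTI; exact: measurable_rot2.
rewrite -(mu2_rot2_shears i0 n0 mA) -(mu2_rot2_shears i0 n0 mp).
congr mu2; apply/seteqP.
suff rE u : rot2 c s u = rot2 0 1 (rot2 0 1 u) by split=> u /=; rewrite rE.
by case: u => x y; rewrite /rot2 /= cE s0; congr (_, _); ring.
Qed.

End Invariance.

(** * Measurability and integrals over the disc *)

Section PlaneMeasurability.
Variable R : realType.
Notation T := (measurableTypeR R).
Notation mu := (@lebesgue_measure R).
Notation mu2 := (mu \x mu)%E.

(** Openness for the sup norm, in terms of coordinates. *)
Definition plane_open (U : set (T * T)) := forall u, U u ->
  exists2 r, 0 < r & forall v : T * T, `|v.1 - u.1| < r -> `|v.2 - u.2| < r -> U v.

(** A set that is open in this sense is the union of the squares with rational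
    centre and radius that it contains. *)
Lemma plane_open_measurable (U : set (T * T)) : plane_open U -> measurable U.
Proof.
move=> oU.
pose sq (q1 q2 q3 : rat) : set (T * T) :=
  `]ratr q1 - ratr q3, ratr q1 + ratr q3[%classic `*`
  `]ratr q2 - ratr q3, ratr q2 + ratr q3[%classic.
pose V q1 q2 q3 := if `[< sq q1 q2 q3 `<=` U >] then sq q1 q2 q3 else set0.
have -> : U = \bigcup_q1 \bigcup_q2 \bigcup_q3 V q1 q2 q3.
  apply/seteqP; split=> [u Uu|u [q1 _ [q2 _ [q3 _]]]]; last first.
    by rewrite /V; case: ifPn => // /asboolP; exact.
  have [r r0 rU] := oU _ Uu.
  have r20 : 0 < r / 2 by rewrite divr_gt0.
  have [q3] := rat_in_itvoo r20.
  rewrite in_itv/= => /andP[q30 q3r].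
  have u1 : u.1 - ratr q3 < u.1 + ratr q3 by lra.
  have [q1] := rat_in_itvoo u1.
  rewrite in_itv/= => /andP[q11 q12].
  have u2 : u.2 - ratr q3 < u.2 + ratr q3 by lra.
  have [q2] := rat_in_itvoo u2.
  rewrite in_itv/= => /andP[q21 q22].
  exists q1 => //; exists q2 => //; exists q3 => //; rewrite /V ifT.
    by split; rewrite /= in_itv/=; apply/andP; split; lra.
  apply/asboolP => v [/=]; rewrite !in_itv/= => /andP[v1 v2] /andP[v3 v4].
  by apply: rU; rewrite ltr_norml; apply/andP; split; lra.
apply: bigcupT_measurable_rat => q1; apply: bigcupT_measurable_rat => q2.
apply: bigcupT_measurable_rat => q3; rewrite /V; case: ifPn => // _.
by apply: measurableX; exact: measurable_itv.
Qed.

Lemma normc_of_plane (u v : T * T) (r : R) :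
  `|v.1 - u.1| < r / 2 -> `|v.2 - u.2| < r / 2 ->
  normc (of_plane v - of_plane u) < r.
Proof.
move=> h1 h2; apply: le_lt_trans (normc_le_ReIm _) _.
by rewrite (splitr r) /= ltrD.
Qed.

Definition disc : set (T * T) := @of_plane R @^-1` (@unit_disc R).

Lemma unit_disc_open (z : R[i]) : unit_disc z ->
  exists2 r, 0 < r & forall w, normc (w - z) < r -> unit_disc w.
Proof.
rewrite /unit_disc /= => z1; exists (1 - normc z); first by rewrite subr_gt0.
by move=> w wz; rewrite /= -[w](subrK z) (le_lt_trans (normcD _ _))// -ltrBrDr.
Qed.

Lemma measurable_disc : measurable disc.
Proof.
apply: plane_open_measurable => u /unit_disc_open[r r0 rP].
exists (r / 2); first by rewrite divr_gt0.
by move=> v h1 h2; apply: rP; exact: normc_of_plane.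
Qed.

Lemma disc_continuous_measurable (f : R[i] -> R) :
  (forall z, unit_disc z -> {for z, continuous (f : R[i]^o -> R)}) ->
  measurable_fun disc (f \o @of_plane R).
Proof.
move=> cf mD; apply: (measurability _ (RGenOInfty.measurableE R)) => //.
move=> /= _ [_ [a ->] <-]; apply: plane_open_measurable => u [Du].
rewrite /= in_itv/= andbT => au.
have [r r0 rP] := unit_disc_open Du.
have /rcontP fu := cf _ Du.
have au0 : 0 < f (of_plane u) - a by rewrite subr_gt0.
have [r' r'0 rP'] := fu _ au0.
exists (Num.min r r' / 2); first by rewrite divr_gt0// lt_min r0.
move=> v h1 h2.
have := normc_of_plane h1 h2; rewrite lt_min => /andP[vr vr'].
split; first exact: rP.
rewrite /= in_itv/= andbT.
by have := rP' _ vr'; rewrite ltr_norml => /andP[+ _]; lra.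
Qed.

(** Lebesgue measure on the plane is used for the computations; [sigma] only
    differs from it by the factor [1 / pi]. *)
Lemma sigma_ge0_integral (D : set (T * T)) (f : T * T -> \bar R) : measurable D ->
  measurable_fun D f -> (forall u, D u -> (0 <= f u)%E) ->
  (\int[sigma R]_(u in D) f u = (pi^-1)%:E * \int[mu2]_(u in D) f u)%E.
Proof.
by move=> mD mf f0; rewrite /sigma ge0_integral_mscale//= mul1r.
Qed.

Lemma sigma_integrableP (D : set (T * T)) (f : T * T -> \bar R) : measurable D ->
  (sigma R).-integrable D f <-> mu2.-integrable D f.
Proof.
move=> mD; have p0 : 0 < (pi^-1 : R) by rewrite invr_gt0 pi_gt0.
split=> /integrableP[mf fi]; apply/integrableP; split => //.
  move: fi; rewrite sigma_ge0_integral//; last exact: measurableT_comp.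
  apply: contraTT; rewrite -!leNgt !leye_eq => /eqP ->.
  by rewrite gt0_muley// lte_fin.
rewrite sigma_ge0_integral//; last exact: measurableT_comp.
by rewrite lte_mul_pinfty// lee_fin ltW.
Qed.

Lemma sigma_integral (D : set (T * T)) (f : T * T -> \bar R) : measurable D ->
  (sigma R).-integrable D f ->
  (\int[sigma R]_(u in D) f u = (pi^-1)%:E * \int[mu2]_(u in D) f u)%E.
Proof.
move=> mD /(sigma_integrableP _ mD) fi; have mf := measurable_int _ fi.
rewrite integralE [in RHS]integralE !sigma_ge0_integral//; first last.
- exact: measurable_funepos.
- exact: measurable_funeneg.
have fp : (\int[mu2]_(u in D) f^\+ u)%E \is a fin_num.
  by apply: integrable_fin_num => //; exact: integrable_funepos.
by apply/esym/(@muleBr _ (pi^-1)%:E (\int[mu2]_(u in D) f^\+ u) (\int[mu2]_(u in D) f^\- u));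
  rewrite ?fin_num_adde_defr.
Qed.

End PlaneMeasurability.

(** * Averaging over circles *)

Section DiscAverage.
Variable R : realType.
Notation T := (measurableTypeR R).
Notation mu := (@lebesgue_measure R).
Notation mu2 := (mu \x mu)%E.

Lemma mu2_sigma_finite : sigma_finite [set: T * T] mu2.
Proof.
exists (fun n : nat => `[- n%:R, n%:R]%classic `*` `[- n%:R, n%:R]%classic).
  apply/seteqP; split => // -[x y] _.
  have [n nP] : exists n : nat, `|x| + `|y| <= n%:R.
    exists (Num.bound (`|x| + `|y|)); apply: ltW.
    by apply: archi_boundP; rewrite addr_ge0.
  have := normr_ge0 x; have := normr_ge0 y => y0 x0.
  by exists n => //; split; rewrite /= in_itv/= -ler_norml; lra.
move=> n; split; first exact: measurableX.
rewrite [ltLHS](product_measure1E mu mu)//= lebesgue_measure_itv/=.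
by case: ifP => _; rewrite ?mul0e ?mule0 ?ltry// -EFinB -EFinM ltry.
Qed.

(** A named copy of the product measure, on which sigma-finiteness can be
    declared for use in iterated products. *)
Definition plane_lebesgue (A : set (T * T)) : \bar R := mu2 A.

Let mu2m : {measure set (T * T)%type -> \bar R} := mu2.

HB.instance Definition _ := isMeasure.Build _ (T * T)%type R plane_lebesgue
  (measure0 mu2m) (measure_ge0 mu2m) (@measure_semi_sigma_additive _ _ _ mu2m).

HB.instance Definition _ :=
  Measure_isSigmaFinite.Build _ (T * T)%type R plane_lebesgue mu2_sigma_finite.

Lemma mu2_integral_rot2_ge0 (c s : R) (f : T * T -> \bar R) : c ^+ 2 + s ^+ 2 = 1 ->
  measurable_fun [set: T * T] f -> (forall u, 0 <= f u)%E ->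
  (\int[mu2]_u f (rot2 c s u) = \int[mu2]_u f u)%E.
Proof.
move=> cs mf f0.
transitivity (\int[pushforward mu2 (rot2 c s)]_u f u)%E; last first.
  apply: eq_measure_integral; first exact: measurable_rot2.
  by move=> mr A mA _; exact: (mu2_rot2 cs mA).
have := @ge0_integral_pushforward _ _ _ _ _ _ (measurable_rot2 c s) mu2 setT f
  measurableT mf (fun u _ => f0 u).
by rewrite preimage_setT => ->.
Qed.

Lemma mu2_integral_rot2 (c s : R) (f : T * T -> \bar R) : c ^+ 2 + s ^+ 2 = 1 ->
  mu2.-integrable setT f ->
  mu2.-integrable setT (f \o rot2 c s) /\
  (\int[mu2]_u f (rot2 c s u) = \int[mu2]_u f u)%E.
Proof.
move=> cs fi; have mf := measurable_int _ fi.
have fir : mu2.-integrable setT (f \o rot2 c s).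
  apply/integrableP; split.
    by apply: measurableT_comp => //; exact: measurable_rot2.
  rewrite /= (@mu2_integral_rot2_ge0 _ _ (fun u => `|f u|%E))//.
    by move/integrableP : fi => [].
  exact: measurableT_comp.
split => //.
transitivity (\int[pushforward mu2 (rot2 c s)]_u f u)%E; last first.
  apply: eq_measure_integral; first exact: measurable_rot2.
  by move=> mr A mA _; exact: (mu2_rot2 cs mA).
have := @integral_pushforward _ _ _ _ _ _ (measurable_rot2 c s) mu2 setT f mf.
by rewrite preimage_setT => /(_ fir measurableT) ->.
Qed.

Lemma of_plane_rot2 t (u : T * T) :
  of_plane (rot2 (cos t) (sin t) u) = rotate t (of_plane u).
Proof.
case: u => x y; rewrite /rotate /cexp /of_plane /rot2 /= expR0; simpc.
by congr (_ +i* _); ring.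
Qed.

Lemma disc_rot2 t (u : T * T) : disc (rot2 (cos t) (sin t) u) <-> disc u.
Proof.
have E : normc (of_plane (rot2 (cos t) (sin t) u)) = normc (of_plane u).
  by rewrite of_plane_rot2 normc_rotate.
by rewrite /disc /preimage /unit_disc /mkset E.
Qed.

(** Rotation invariance and Fubini: over the disc, a function may be replaced by
    its means over circles centred at the origin. *)
Lemma disc_average (H m : R[i] -> R) :
  mu2.-integrable (@disc R) (fun u => (H (of_plane u))%:E) ->
  (forall z, unit_disc z -> seg_cont (fun t => H (rotate t z)) 0 (pi *+ 2) /\
     sint (fun t => H (rotate t z)) 0 (pi *+ 2) = m z * (pi *+ 2)) ->
  (\int[mu2]_(u in @disc R) (H (of_plane u))%:E =
   \int[mu2]_(u in @disc R) (m (of_plane u))%:E)%E.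
Proof.
move=> Hi Hm; have mD := @measurable_disc R.
pose g : T * T -> R := (H \o @of_plane R) \_ (@disc R).
have gi : mu2.-integrable setT (EFin \o g).
  rewrite /g -restrict_EFin.
  by move/(integrable_mkcond _ mD) : Hi.
have mg : measurable_fun [set: T * T] g.
  by apply/measurable_EFinP; exact: measurable_int gi.
pose I := `[0, pi *+ 2]%classic : set T.
have p2 : 0 < pi *+ 2 :> R by rewrite mulrn_wgt0// pi_gt0.
(* Averaging over the angle is integration against the weight [wt]; [g] is
   extended by [0] so that all the integrals are over the whole plane. *)
pose wt (t : T) : R := (pi *+ 2)^-1 * \1_I t.
pose J (w : (T * T) * T) : \bar R := (g (rot2 (cos w.2) (sin w.2) w.1) * wt w.2)%:E.
have mI : measurable I by exact: measurable_itv.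
have mrot : measurable_fun [set: (T * T) * T]
    (fun w : (T * T) * T => rot2 (cos w.2) (sin w.2) w.1).
  have m1 : measurable_fun [set: (T * T) * T] (fun w : (T * T) * T => w.1.1).
    by apply: (measurableT_comp measurable_fst); exact: measurable_fst.
  have m2 : measurable_fun [set: (T * T) * T] (fun w : (T * T) * T => w.1.2).
    by apply: (measurableT_comp measurable_snd); exact: measurable_fst.
  have mc : measurable_fun [set: (T * T) * T] (fun w : (T * T) * T => cos w.2).
    apply: (measurableT_comp (f := @cos R)); last exact: measurable_snd.
    by apply: continuous_measurable_fun; exact: continuous_cos.
  have ms : measurable_fun [set: (T * T) * T] (fun w : (T * T) * T => sin w.2).
    apply: (measurableT_comp (f := @sin R)); last exact: measurable_snd.
    by apply: continuous_measurable_fun; exact: continuous_sin.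
  by apply: measurable_fun_pair; [apply: measurable_funB|apply: measurable_funD];
    exact: measurable_funM.
have mwt : measurable_fun [set: T] wt.
  by apply: measurable_funM; [exact: measurable_cst|exact: measurable_indic].
have wt0 t : 0 <= wt t by rewrite mulr_ge0// ?invr_ge0 ?ltW// indicE ler0n.
have mJ : measurable_fun [set: (T * T) * T] J.
  apply/measurable_EFinP; apply: measurable_funM; first exact: (measurableT_comp mg).
  by apply: (measurableT_comp mwt); exact: measurable_snd.
have trig t : cos t ^+ 2 + sin t ^+ 2 = 1 :> R by rewrite cos2Dsin2.
have muI : mu I = (pi *+ 2)%:E.
  by rewrite /I lebesgue_measure_itv/= lte_fin p2 sube0.
have wtE (c : T -> \bar R) : (\int[mu]_t (c t * (wt t)%:E) =
    \int[mu]_(t in I) (c t * ((pi *+ 2)^-1)%:E))%E.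
  rewrite [RHS]integral_mkcond; apply: eq_integral => t _.
  rewrite /patch /wt indicE; case: ifP => _; first by rewrite mulr1.
  by rewrite mulr0 mule0.
have intI (c : \bar R) : (\int[mu]_t (c * (wt t)%:E) = c)%E.
  rewrite (wtE (fun=> c)) integral_cst// [X in (_ * X)%E](_ : _ = (pi *+ 2)%:E)//.
  by rewrite -muleA -EFinM mulVf ?gt_eqF// mule1.
have JE t : (\int[mu2]_u J (u, t) = (\int[mu2]_u (g u)%:E) * (wt t)%:E)%E.
  have [gri grE] := mu2_integral_rot2 (trig t) gi.
  rewrite -grE -integralZr//.
have JabsE t : (\int[mu2]_u `|J (u, t)| = (\int[mu2]_u `|(g u)%:E|) * (wt t)%:E)%E.
  have mag : measurable_fun [set: T * T] (fun u => `|(g u)%:E|%E).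
    by apply: measurableT_comp => //; exact/measurable_EFinP.
  have [gri _] := mu2_integral_rot2 (trig t) gi.
  rewrite -(mu2_integral_rot2_ge0 (trig t) mag)// -ge0_integralZr//.
  - by apply: eq_integral => u _; rewrite /J /= normrM EFinM (ger0_norm (wt0 t)).
  - by apply: measurableT_comp => //; exact: measurable_int gri.
  - by rewrite lee_fin.
pose M2 : {sigma_finite_measure set (T * T)%type -> \bar R} := plane_lebesgue.
have JE2 t : (\int[M2]_u J (u, t) = (\int[mu2]_u (g u)%:E) * (wt t)%:E)%E := JE t.
have JabsE2 t : (\int[M2]_u `|J (u, t)| = (\int[mu2]_u `|(g u)%:E|) * (wt t)%:E)%E := JabsE t.
have Ji : (M2 \x mu)%E.-integrable setT J.
  apply: (proj2 (@integrable21ltyP _ _ _ _ R M2 mu J mJ)).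
  under eq_integral do rewrite JabsE2.
  by rewrite intI; move/integrableP : gi => [].
transitivity (\int[mu2]_u (g u)%:E)%E.
  by rewrite [LHS]integral_mkcond; apply: eq_integral => u _; rewrite /g restrict_EFin.
transitivity (\int[mu]_t \int[M2]_u J (u, t))%E.
  by under [RHS]eq_integral do rewrite JE2; rewrite intI.
have := @Fubini _ _ _ _ R M2 mu J Ji => /esym ->.
rewrite [RHS]integral_mkcond; apply: eq_integral => u _.
rewrite [RHS]/patch; case: ifPn => [/set_mem Du|/negP Du].
  have [cH HE] := Hm _ Du.
  have gE t : g (rot2 (cos t) (sin t) u) = H (rotate t (of_plane u)).
    by rewrite /g /patch ifT ?inE ?disc_rot2//= of_plane_rot2.
  rewrite /J /=; under eq_integral do rewrite gE EFinM.
  have Hit := seg_cont_integrable cH.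
  rewrite wtE integralZr//.
  have -> : (\int[mu]_(t in I) (H (rotate t (of_plane u)))%:E)%E =
    (sint (fun t => H (rotate t (of_plane u))) 0 (pi *+ 2))%:E.
    by rewrite /sint fineK//; exact: integrable_fin_num.
  by rewrite HE -EFinM mulfK ?gt_eqF.
rewrite integral0_eq// => t _; rewrite /J /= /g /patch ifF ?mul0r//.
by apply/negP => /set_mem/disc_rot2 Du'; apply: Du; rewrite inE.
Qed.

End DiscAverage.

(** * Area and radial moments of the disc *)

Section DiscArea.
Variable R : realType.
Notation T := (measurableTypeR R).
Notation mu := (@lebesgue_measure R).
Notation mu2 := (mu \x mu)%E.

Lemma derive1_is_derive (f : R -> R) (df : R -> R) :
  (forall x : R, is_derive x 1 f (df x)) -> f^`()%classic = df.
Proof. by move=> h; apply/funext => x; rewrite derive1E; have := h x => -[]. Qed.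

Lemma derivable_oo_LRcontinuousT (f : R -> R) a b :
  (forall x : R, derivable f x 1) -> derivable_oo_LRcontinuous f a b.
Proof.
move=> df; have cf x : {for x, continuous f}.
  by apply: differentiable_continuous; apply/derivable1_diffP.
split=> [x _//| |].
- exact/cvg_at_right_filter/cf.
- exact/cvg_at_left_filter/cf.
Qed.

Lemma FTC2_everywhere (f F : R -> R) a b : a <= b ->
  continuous f -> (forall x : R, is_derive x 1 F (f x)) ->
  (\int[mu]_(x in `[a, b]) (f x)%:E = (F b - F a)%:E)%E.
Proof.
rewrite le_eqVlt => /predU1P[->|ab] cf dF.
  by rewrite set_itv1 integral_set1 subrr.
rewrite (@continuous_FTC2 _ f F)//.
- exact: continuous_subspaceT.
- by apply: derivable_oo_LRcontinuousT => x; have [] := dF x.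
- by move=> x _; rewrite (derive1_is_derive dF).
Qed.

(** Substitution [x = r * sin t]. *)
Lemma half_disc_area (r : R) : 0 < r ->
  (\int[mu]_(x in `[(- r)%R, r]) (2 * Num.sqrt (r ^+ 2 - x ^+ 2))%:E =
   (pi * r ^+ 2)%:E)%E.
Proof.
move=> r0; pose F (t : R) := r * sin t.
have dF (t : R) : is_derive t 1 F (r * cos t).
  by have := is_deriveZ r (is_derive_sin t).
have F' := derive1_is_derive dF.
pose G (x : R) := 2 * Num.sqrt (r ^+ 2 - x ^+ 2).
have cG : continuous G.
  move=> x; apply: (@continuousM R R^o (fun=> 2) (fun x => Num.sqrt (r ^+ 2 - x ^+ 2))).
    exact: cst_continuous.
  apply: (@continuous_comp _ _ _ (fun x : R => r ^+ 2 - x ^+ 2) (@Num.sqrt R)).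
    by apply: continuousB; [exact: cst_continuous|exact: exprn_continuous].
  exact: sqrt_continuous.
have p0 : 0 < pi / 2 :> R by rewrite divr_gt0// pi_gt0.
have pp : - (pi / 2) <= pi / 2 :> R by lra.
have crc : continuous (fun t : R => r * cos t).
  move=> t; apply: (@continuousM R R^o (fun=> r) (@cos R)); first exact: cst_continuous.
  exact: continuous_cos.
have Fr : F (pi / 2) = r by rewrite /F sin_pihalf mulr1.
have FNr : F (- (pi / 2)) = - r by rewrite /F sinN sin_pihalf mulrN1.
rewrite -[X in `[X, _]]FNr -[X in `[_, X]]Fr.
rewrite (@integration_by_substitution_increasing _ F G)//; first last.
- exact: continuous_subspaceT.
- by apply: derivable_oo_LRcontinuousT => t; have [] := dF t.
- by rewrite F'; apply/cvg_ex; eexists; exact/cvg_at_left_filter/crc.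
- by rewrite F'; apply/cvg_ex; eexists; exact/cvg_at_right_filter/crc.
- by rewrite F' => t _; exact: crc.
- by move=> s t si ti st; rewrite /F ltr_pM2l// ltr_sin.
transitivity (\int[mu]_(t in `[(- (pi / 2))%R, (pi / 2)%R]) (2 * r ^+ 2 * cos t ^+ 2)%:E)%E.
  apply: eq_integral => t; rewrite inE/= in_itv/= => /andP[t1 t2].
  have c0 : 0 <= cos t by apply: cos_ge0_pihalf; rewrite t1 t2.
  have GF : G (F t) = 2 * (r * cos t).
    rewrite /G (_ : r ^+ 2 - F t ^+ 2 = (r * cos t) ^+ 2).
      by rewrite sqrtr_sqr ger0_norm ?mulr_ge0// ltW.
    by rewrite /F !exprMn cos2sin2; ring.
  by rewrite F' [LHS](_ : _ = (G (F t) * (r * cos t))%:E)// GF; congr EFin; ring.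
pose K (t : R) := r ^+ 2 * (t + sin t * cos t).
have cK : continuous (fun t : R => 2 * r ^+ 2 * cos t ^+ 2).
  move=> t; apply: (@continuousM R R^o (fun=> 2 * r ^+ 2) (fun t => cos t ^+ 2)).
    exact: cst_continuous.
  apply: (@continuous_comp _ _ _ (@cos R) (fun x : R => x ^+ 2)).
    exact: continuous_cos.
  exact: exprn_continuous.
have dK (t : R) : is_derive t 1 K (2 * r ^+ 2 * cos t ^+ 2).
  have := is_deriveZ (r ^+ 2)
    (is_deriveD (is_derive_id t 1) (is_deriveM (is_derive_sin t) (is_derive_cos t))).
  rewrite /GRing.scale/= => H; apply: is_derive_eq H _.
  have -> : 2 * r ^+ 2 * cos t ^+ 2 = r ^+ 2 * (1 + cos t ^+ 2 - sin t ^+ 2).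
    by rewrite cos2sin2; ring.
  by ring.
rewrite (FTC2_everywhere pp cK dK); congr EFin.
by rewrite /K sinN cosN cos_pihalf; field.
Qed.

(** By Cavalieri: the vertical chord at [x] has length [2 * sqrt (r ^+ 2 - x ^+ 2)]. *)
Lemma disc_area (r : R) : 0 < r ->
  mu2 [set u : T * T | u.1 ^+ 2 + u.2 ^+ 2 < r ^+ 2] = (pi * r ^+ 2)%:E.
Proof.
move=> r0; set A := [set u | _].
rewrite -(half_disc_area r0) /product_measure1 [RHS]integral_mkcond.
apply: eq_integral => x _ /=.
set s := Num.sqrt (r ^+ 2 - x ^+ 2).
have s0 : 0 <= s by exact: sqrtr_ge0.
have -> : xsection A x = `]- s, s[%classic.
  apply/seteqP; split => y; rewrite /xsection /= inE /A /= in_itv/=.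
    move=> h; rewrite -ltr_norml -[ltLHS]sqrtr_sqr ltr_sqrt; first by lra.
    by have := sqr_ge0 y; lra.
  move=> h; have : `|y| < s by rewrite ltr_norml.
  rewrite -[X in X < _]sqrtr_sqr; have [xr|xr] := ltP 0 (r ^+ 2 - x ^+ 2).
    by rewrite ltr_sqrt//; lra.
  by rewrite /s (ler0_sqrtr xr) ltNge sqrtr_ge0.
rewrite /patch [RHS]/=; case: ifPn => [|]; rewrite lebesgue_measure_itv/= lte_fin.
  rewrite inE/= in_itv/= => xr; case: ifPn => [_|].
    by rewrite -EFinB; congr EFin; rewrite -/s; ring.
  rewrite -leNgt -/s => ss; have sE : s = 0 by lra.
  by rewrite sE mulr0.
move=> /negP; rewrite inE/= in_itv/= -ler_norml => /negP; rewrite -ltNge => rx.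
have -> : s = 0; last by rewrite oppr0 ltxx.
apply: ler0_sqrtr; rewrite subr_le0 -(real_normK (num_real x)).
by rewrite ler_sqr ?nnegrE ?ltW// (lt_trans r0).
Qed.

End DiscArea.

Section DiscMoments.
Variable R : realType.
Notation T := (measurableTypeR R).
Notation mu := (@lebesgue_measure R).
Notation mu2 := (mu \x mu)%E.

Definition sqrad (u : T * T) : R := u.1 ^+ 2 + u.2 ^+ 2.

Lemma sqrad_ge0 u : 0 <= sqrad u.
Proof. by rewrite addr_ge0 ?sqr_ge0. Qed.

Lemma sqradE u : sqrad u = normc (of_plane u) ^+ 2.
Proof. by rewrite sqr_normcE. Qed.

Lemma discE u : @disc R u <-> sqrad u < 1.
Proof.
rewrite sqradE; split; rewrite /disc /unit_disc /preimage /mkset => h.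
  by rewrite expr_lt1// normc_ge0.
by rewrite expr_lt1// normc_ge0 in h.
Qed.

Lemma measurable_sqrad : measurable_fun [set: T * T] sqrad.
Proof.
by apply: measurable_funD; apply: measurable_funX;
  [exact: measurable_fst|exact: measurable_snd].
Qed.

Lemma powers_integral (n : nat) (a b : R) : a <= b ->
  (\int[mu]_(t in `[a, b]) (n%:R * t ^+ n.-1)%:E = (b ^+ n - a ^+ n)%:E)%E.
Proof.
move=> ab; apply: (FTC2_everywhere (F := fun t => t ^+ n)) => //.
  move=> x; apply: (@continuousM R R^o (fun=> n%:R) (fun t => t ^+ n.-1)).
    exact: cst_continuous.
  exact: exprn_continuous.
move=> t; have := is_deriveX n (is_derive_id t 1).
have -> : (id : R -> R) ^+ n = fun x => x ^+ n by apply/funext => x; rewrite fctE.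
by rewrite /GRing.scale/= mulr1 -[(_ *+ n)]mulr_natl.
Qed.

Lemma disc_measure : mu2 (@disc R) = pi%:E.
Proof.
have := disc_area (ltr01 : 0 < 1 :> R); rewrite expr1n mulr1 => <-.
by congr mu2; apply/seteqP; split=> u /discE.
Qed.

(** Layer-cake: [1 - q ^+ n] is the integral of [n * t ^+ n.-1] over [q < t < 1],
    and the discs [sqrad u < t] have area [pi * t]. *)
Lemma disc_comoment (n : nat) :
  (\int[mu2]_(u in @disc R) (1 - sqrad u ^+ n)%:E = (pi * (n%:R / n.+1%:R))%:E)%E.
Proof.
pose S (w : (T * T) * T) := (sqrad w.1 < w.2) && (w.2 < 1).
pose f (w : (T * T) * T) : \bar R :=
  ((n%:R * w.2 ^+ n.-1) * \1_[set w | S w] w)%:E.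
have m2 : measurable_fun [set: (T * T) * T] (fun w : (T * T) * T => w.2).
  exact: measurable_snd.
have mS : measurable [set w | S w].
  rewrite [X in measurable X](_ : _ =
    (fun w : (T * T) * T => w.2 - sqrad w.1) @^-1` `]0, +oo[ `&`
    (fun w : (T * T) * T => w.2) @^-1` `]-oo, 1[).
    apply: measurableI; rewrite -[X in measurable X]setTI.
      apply: (measurable_funB m2) => //.
      by apply: (measurableT_comp measurable_sqrad); exact: measurable_fst.
    exact: m2.
  by apply/seteqP; split=> w; rewrite /S /= !in_itv/= subr_gt0 andbT => /andP.
have mf : measurable_fun [set: (T * T) * T] f.
  apply/measurable_EFinP; apply: measurable_funM; last exact: measurable_indic.
  by apply: measurable_funM; [exact: measurable_cst|exact: measurable_funX].
have Sf w : f w = if S w then (n%:R * w.2 ^+ n.-1)%:E else 0%E.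
  by rewrite /f indicE; case: ifPn => [Sw|/negP Sw];
    [rewrite mem_set ?mulr1|rewrite memNset ?mulr0].
have f0 w : (0 <= f w)%E.
  rewrite Sf; case: ifPn => // /andP[w1 _]; rewrite lee_fin mulr_ge0// exprn_ge0//.
  by rewrite (le_trans _ (ltW w1))// sqrad_ge0.
pose M2 : {sigma_finite_measure set (T * T)%type -> \bar R} := @plane_lebesgue R.
have := @fubini_tonelli _ _ _ _ R M2 mu f mf f0.
have -> : (\int[M2]_u \int[mu]_t f (u, t) = \int[mu2]_(u in @disc R) (1 - sqrad u ^+ n)%:E)%E.
  rewrite [RHS]integral_mkcond; apply: eq_integral => u _.
  rewrite [RHS]/patch; case: ifPn => [/set_mem/discE u1|/negP u1]; last first.
    rewrite integral0_eq// => t _; rewrite Sf /S /=; case: ifPn => // /andP[ut t1].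
    by exfalso; apply: u1; apply/mem_set/discE; exact: lt_trans ut t1.
  have := powers_integral n (ltW u1); rewrite expr1n => <-.
  transitivity (\int[mu]_(t in `]sqrad u, 1%R[) (n%:R * t ^+ n.-1)%:E)%E.
    rewrite [RHS]integral_mkcond; apply: eq_integral => t _.
    by rewrite Sf /patch /S /= mem_setE in_itv.
  rewrite integral_itv_bndo_bndc ?integral_itv_obnd_cbnd//;
    by apply/measurable_EFinP; apply: measurable_funM; [exact: measurable_cst|exact: exprn_measurable].
move=> ->.
transitivity (\int[mu]_(t in `]0%R, 1%R[) (pi * n%:R * t ^+ n)%:E)%E.
  rewrite [RHS]integral_mkcond; apply: eq_integral => t _.
  rewrite [RHS]/patch mem_setE in_itv/=; case: ifPn => [/andP[t0 t1]|t01]; last first.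
    rewrite integral0_eq// => u _; rewrite Sf /S /=; case: ifPn => // /andP[ut t1].
    by rewrite t1 (le_lt_trans (sqrad_ge0 u) ut) in t01.
  pose At : set (T * T) := [set u | sqrad u < t].
  have mAt : measurable At.
    rewrite -[X in measurable X]setTI.
    rewrite [X in _ `&` X](_ : _ = sqrad @^-1` `]-oo, t[).
      by apply: measurable_sqrad => //; exact: measurable_itv.
    by apply/seteqP; split=> u /=; rewrite in_itv.
  transitivity ((n%:R * t ^+ n.-1)%:E * mu2 At)%E.
    rewrite -(integral_cst mu2 mAt) [RHS]integral_mkcond; apply: eq_integral => u _.
    by rewrite Sf /patch /S /= t1 andbT mem_setE.
  have st : Num.sqrt t ^+ 2 = t by rewrite sqr_sqrtr// ltW.
  have s0 : 0 < Num.sqrt t by rewrite sqrtr_gt0.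
  have := disc_area s0; rewrite st => ->.
  rewrite -EFinM; congr EFin; case: (n) => [|k]; first by rewrite !(mul0r, mulr0).
  by rewrite exprS /=; ring.
rewrite integral_itv_bndo_bndc ?integral_itv_obnd_cbnd//;
  try by apply/measurable_EFinP; apply: measurable_funM;
    [exact: measurable_cst|exact: exprn_measurable].
have n0 : n.+1%:R != 0 :> R by rewrite pnatr_eq0.
pose F (t : R) := pi * (n%:R / n.+1%:R) * t ^+ n.+1.
have dF (t : R) : is_derive t 1 F (pi * n%:R * t ^+ n).
  have := is_deriveZ (pi * (n%:R / n.+1%:R)) (is_deriveX n.+1 (is_derive_id t 1)).
  have -> : (id : R -> R) ^+ n.+1 = fun x => x ^+ n.+1 by apply/funext => x; rewrite fctE.
  rewrite /GRing.scale/= mulr1 => H; apply: is_derive_eq H _.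
  by rewrite -[(_ *+ n.+1)]mulr_natl; field.
have cf : continuous (fun t : R => pi * n%:R * t ^+ n).
  move=> x; apply: (@continuousM R R^o (fun=> pi * n%:R) (fun t => t ^+ n)).
    exact: cst_continuous.
  exact: exprn_continuous.
rewrite (FTC2_everywhere ler01 cf dF); congr EFin.
by rewrite /F expr1n expr0n/= mulr0 subr0 mulr1.
Qed.

(** With [q = |z| ^+ 2], the normalized area is [dq] on [0 < q < 1]. *)
Lemma disc_moment (n : nat) :
  (\int[mu2]_(u in @disc R) (sqrad u ^+ n)%:E = (pi / n.+1%:R)%:E)%E.
Proof.
have mD := @measurable_disc R.
have ms : measurable_fun (@disc R) (fun u => sqrad u ^+ n).
  apply: measurable_funTS; apply: measurable_funX; exact: measurable_sqrad.
have le1 u : @disc R u -> 0 <= sqrad u ^+ n <= 1.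
  move=> /discE u1; rewrite exprn_ge0 ?sqrad_ge0//= exprn_ile1// ?sqrad_ge0//.
  exact: ltW.
have D0 : (\int[mu2]_(u in @disc R) (1 - sqrad u ^+ n)%:E +
   \int[mu2]_(u in @disc R) (sqrad u ^+ n)%:E = pi%:E)%E.
  rewrite -ge0_integralD//.
  - rewrite -disc_measure -[RHS]mul1e -integral_cst//.
    by apply: eq_integral => u _; rewrite -EFinD subrK.
  - by move=> u /le1 /andP[_ ?]; rewrite lee_fin subr_ge0.
  - by apply/measurable_EFinP; apply: measurable_funB => //; exact: measurable_cst.
  - by move=> u /le1 /andP[? _]; rewrite lee_fin.
  - exact/measurable_EFinP.
move: D0; rewrite disc_comoment => /esym/eqP; rewrite addeC -sube_eq//; last first.
  by rewrite fin_num_adde_defl.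
move=> /eqP <-; rewrite -EFinB; congr EFin.
have n1 : n%:R + 1 != 0 :> R by rewrite natr1 pnatr_eq0.
by rewrite -natr1; field.
Qed.

End DiscMoments.

(** * Convexity and the parameters *)

Section PowerConvexity.
Variable R : realType.
Implicit Types p x : R.

(** Strict concavity of [ln] applied to the mean of [x `^ p] and [1] with weights
    [1 / p] and [1 - 1 / p]. *)
Lemma powR_tangent p x : 1 < p -> 0 <= x ->
  1 + p * (x - 1) <= x `^ p ?= iff (x == 1).
Proof.
move=> p1 x0; have p0 : 0 < p by exact: lt_trans p1.
have ltx : x != 1 -> 1 + p * (x - 1) < x `^ p.
  move=> x1; move: x0; rewrite le_eqVlt => /predU1P[<-|x0].
    by rewrite powR0 ?gt_eqF//; lra.
  set A := x `^ p; have A0 : 0 < A by exact: powR_gt0.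
  rewrite ltNge; apply/negP => Ax.
  (* If the inequality failed, the weighted mean [m] of [A] and [1] would be at
     most [x], while [ln m >= ln x] by concavity. *)
  pose m := (A + (p - 1)) / p.
  have m0 : 0 < m by rewrite divr_gt0// addr_gt0// subr_gt0.
  have mx : m <= x by rewrite /m ler_pdivrMr//; lra.
  have lnA : ln A = p * ln x by rewrite /A ln_powR.
  have lnmx : ln m <= ln x by rewrite ler_ln ?posrE.
  have ln_lt (y : R) : 0 < y -> y != 1 -> ln y < y - 1.
    move=> y0 y1; have l0 : ln y != 0 by rewrite ln_eq0.
    by have := expR_gt1Dx l0; rewrite lnK ?posrE//; lra.
  have ln_le (y : R) : 0 < y -> ln y <= y - 1.
    by move=> y0; have [->|/ln_lt/ltW] := eqVneq y 1; [rewrite ln1 subrr|exact].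
  have [m1|m1] := eqVneq m 1.
    have A1 : A = 1 by move: m1; rewrite /m => /(congr1 ( *%R^~ p)); rewrite divfK ?gt_eqF//; lra.
    move: lnA; rewrite A1 ln1 => /esym/eqP; rewrite mulf_eq0 gt_eqF//= ln_eq0//.
    by rewrite (negbTE x1).
  have hu := ln_le (A / m) (divr_gt0 A0 m0).
  have hv : ln (m^-1) < m^-1 - 1 by rewrite ln_lt ?invr_gt0 ?invr_eq1.
  rewrite ln_div ?posrE// in hu; rewrite lnV ?posrE// in hv.
  have sum0 : A / m - 1 + (p - 1) * (m^-1 - 1) = 0.
    by rewrite /m; field; rewrite !gt_eqF// addr_gt0// subr_gt0.
  have : (p - 1) * (- ln m) < (p - 1) * (m^-1 - 1) by rewrite ltr_pM2l// subr_gt0.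
  have : p * ln m <= p * ln x by rewrite ler_pM2l.
  by lra.
have [->|x1] := eqVneq x 1.
  by split; rewrite powR1 subrr mulr0 addr0 ?lexx ?eqxx.
by split; [exact: ltW (ltx x1)|rewrite lt_eqF// ltx].
Qed.

(** The tangent inequality of the strictly convex function [|w| ^ p] at [v],
    whose real gradient is [p * |v| ^ p / v] (conjugated). *)
Lemma normc_powR_tangent p (v w : R[i]) : 1 < p -> v != 0 ->
  normc v `^ p + p * (complex.Re ((normc v `^ p)%:C / v * w) - normc v `^ p)
    <= normc w `^ p ?= iff (w == v).
Proof.
move=> p1 v0; set V := normc v `^ p.
have V0 : 0 < V by rewrite powR_gt0// normc_gt0.
have p0 : 0 < p by exact: lt_trans p1.
pose t := w / v.
have -> : V%:C / v * w = V%:C * t by rewrite /t; field.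
rewrite ReZ; have wE : w = v * t by rewrite /t mulrC divfK.
have -> : normc w `^ p = V * normc t `^ p.
  by rewrite wE normcM powRM ?normc_ge0.
have -> : (w == v) = (t == 1).
  by rewrite -[RHS](inj_eq (mulIf v0)) divfK// mul1r.
have -> : V + p * (V * complex.Re t - V) = V * (1 + p * (complex.Re t - 1)) by ring.
have [h1 h2] := powR_tangent p1 (normc_ge0 t).
have Rt : complex.Re t <= normc t by exact: le_trans (ler_norm _) (normc_Re t).
have h3 : 1 + p * (complex.Re t - 1) <= 1 + p * (normc t - 1).
  by rewrite lerD2l ler_pM2l// lerD2r.
split; first by rewrite ler_pM2l// (le_trans h3).
rewrite (inj_eq (mulfI (lt0r_neq0 V0))).
apply/eqP/eqP => [E|->]; last by rewrite normc1 powR1 /= subrr mulr0 addr0.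
have nt : normc t = 1.
  by apply/eqP; rewrite -h2 eq_le h1 -E h3.
have Rt1 : complex.Re t = 1.
  move: E; rewrite nt powR1 => E.
  have /eqP : p * (complex.Re t - 1) = 0 by lra.
  by rewrite mulf_eq0 gt_eqF//= subr_eq0 => /eqP.
have It : complex.Im t = 0.
  have := sqr_normcE t; rewrite nt Rt1 => h.
  by apply/eqP; rewrite -sqrf_eq0; apply/eqP; lra.
by case: (t) Rt1 It => x y /= -> ->.
Qed.

End PowerConvexity.

Section KernelShift.
Variable R : realType.

(** With [a = t * csgn b], the equation [conj b = conj a + c / a] becomes
    [t ^+ 2 - |b| * t + c = 0]. For [|b| = 1 + c] its roots are [1] and [c], and
    the larger root increases with [|b|]. *)
Lemma root_facts (c : R) (a b : R[i]) : -1 < c -> c < 1 -> 1 + c <= normc b ->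
  a = ((normc b + Num.sqrt (normc b ^+ 2 - 4 * c)) / 2)%:C * csgn b ->
  1 <= normc a /\ conjc b = conjc a + c%:C / a.
Proof.
move=> c0 c1 hb ->; set t := (_ / 2).
have b0 : b != 0 by rewrite -normc_gt0; lra.
have nb : 0 < normc b by rewrite normc_gt0.
(* This lower bound of the discriminant is its value at [|b| = 1 + c]. *)
have disc0 : (1 - c) ^+ 2 <= normc b ^+ 2 - 4 * c by nra.
have s1 : 1 - c <= Num.sqrt (normc b ^+ 2 - 4 * c).
  by have := ler_wsqrtr disc0; rewrite sqrtr_sqr ger0_norm// subr_ge0 ltW.
have t1 : 1 <= t by rewrite /t; lra.
have t0 : t != 0 by rewrite gt_eqF//; lra.
have tq : t ^+ 2 - normc b * t + c = 0.
  have := sqr_sqrtr (le_trans (sqr_ge0 _) disc0) => S.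
  rewrite /t; set q := Num.sqrt _ in S *.
  rewrite [LHS](_ : _ = (q ^+ 2 - normc b ^+ 2 + 4 * c) / 4); last by field.
  by rewrite S; field.
have nbC : (normc b)%:C != 0 :> R[i] by rewrite (inj_eq (@complexI R) _ 0) gt_eqF.
have ncs : normc (csgn b) = 1.
  by rewrite /csgn normcM normcV normc_real ger0_norm ?normc_ge0// divff ?gt_eqF.
split; first by rewrite normcM ncs mulr1 normc_real (le_trans t1)// ler_norm.
have cs0 : csgn b != 0 by rewrite -normc_gt0 ncs.
have csV : (csgn b)^-1 = conjc (csgn b).
  by apply: (mulfI cs0); rewrite mul_conjc ncs expr1n divff.
have bE : b = (normc b)%:C * csgn b by rewrite /csgn mulrCA divff// mulr1.
have conjZ (x : R) z : conjc (x%:C * z) = x%:C * conjc z.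
  by rewrite rmorphM; congr (_ * _); exact: conjc_real.
rewrite invfM csV [in LHS]bE !conjZ.
have -> : normc b = t + c / t by apply: (mulIf t0); rewrite mulrDl divfK//; lra.
have tC : t%:C != 0 :> R[i] by rewrite (inj_eq (@complexI R) _ 0).
rewrite [(t + c / t)%:C](_ : _ = t%:C + c%:C / t%:C); first by field.
by rewrite -fmorph_div -rmorphD.
Qed.

End KernelShift.

(** * Branches of powers *)

Section PowerBranch.
Variable R : realType.
Implicit Types z w a : R[i].

Lemma derivable_cmul (f g : R[i] -> R[i]) z :
  derivable (f : R[i]^o -> R[i]^o) z 1 -> derivable (g : R[i]^o -> R[i]^o) z 1 ->
  derivable ((fun w => f w * g w) : R[i]^o -> R[i]^o) z 1.
Proof. by move=> df dg; exact: (derivableM df dg). Qed.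

Lemma derivable_cadd (f g : R[i] -> R[i]) z :
  derivable (f : R[i]^o -> R[i]^o) z 1 -> derivable (g : R[i]^o -> R[i]^o) z 1 ->
  derivable ((fun w => f w + g w) : R[i]^o -> R[i]^o) z 1.
Proof. by move=> df dg; exact: (derivableD df dg). Qed.

Lemma derivable_cinv (f : R[i] -> R[i]) z : f z != 0 ->
  derivable (f : R[i]^o -> R[i]^o) z 1 ->
  derivable ((fun w => (f w)^-1) : R[i]^o -> R[i]^o) z 1.
Proof. by move=> f0 df; exact: (derivableV f0 df). Qed.

Lemma derivable_ccst (c : R[i]) z : derivable ((fun=> c) : R[i]^o -> R[i]^o) z 1.
Proof. exact: derivable_cst. Qed.

Lemma cexp_surj a : a != 0 -> exists l, cexp l = a.
Proof.
move=> a0; have n0 : 0 < normc a by rewrite normc_gt0.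
pose x := complex.Re a / normc a; pose y := complex.Im a / normc a.
have xy : x ^+ 2 + y ^+ 2 = 1.
  by rewrite !expr_div_n -mulrDl -sqr_normcE divff// expf_neq0// gt_eqF.
have x1 : -1 <= x <= 1.
  by rewrite -ler_norml normrM normfV (ger0_norm (normc_ge0 a)) ler_pdivrMr// mul1r normc_Re.
have cx : cos (acos x) = x by rewrite acosK// in_itv/=.
have sx : sin (acos x) = `|y|.
  by rewrite sin_acos// -sqrtr_sqr; congr Num.sqrt; lra.
have aE : a = (normc a)%:C * (x +i* y).
  rewrite /x /y; case: (a) n0 => u v n0; simpc.
  by congr (_ +i* _); rewrite mulrC divfK ?gt_eqF.
have [y0|y0] := leP 0 y.
  exists (ln (normc a) +i* acos x).
  by rewrite /cexp /= lnK ?posrE// cx sx ger0_norm// -aE.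
exists (ln (normc a) +i* - acos x).
by rewrite /cexp /= lnK ?posrE// cosN sinN cx sx ltr0_norm// opprK -aE.
Qed.

(** Since [|z ^+ N / a| < 1], the values of [1 + z ^+ N / a] stay in the right
    half-plane, where [clog] is holomorphic. *)
Lemma log_branch_exists N a : (1 <= N)%N -> 1 <= normc a ->
  exists L : R[i] -> R[i], analytic_on_disc L /\
    forall z, unit_disc z -> cexp (L z) = z ^+ N + a.
Proof.
move=> N1 a1; have a0 : a != 0 by rewrite -normc_gt0 (lt_le_trans ltr01).
have [l lE] := cexp_surj a0.
have pos z : unit_disc z -> 0 < complex.Re (a^-1 * z ^+ N + 1).
  rewrite /unit_disc /= => z1; rewrite ReD /=.
  have : normc (a^-1 * z ^+ N) < 1.
    rewrite normcM normcV normcX ltr_pdivrMl ?(lt_le_trans ltr01)// mulr1.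
    by rewrite (lt_le_trans _ a1)// exprn_ilt1 ?normc_ge0// -lt0n.
  by move=> /(le_lt_trans (normc_Re _)); rewrite ltr_norml => /andP[+ _]; lra.
exists (fun z => clog (a^-1 * z ^+ N + 1) + l); split=> [z z1|z z1]; last first.
  by rewrite cexpD cexp_clog ?pos// lE; field.
apply: derivable_cadd; last exact: derivable_ccst.
apply: (@derivable_ccomp _ (fun z => a^-1 * z ^+ N + 1) (@clog R)); last first.
  by apply: derivable_clog; exact: pos.
apply: derivable_cadd; last exact: derivable_ccst.
by apply: derivable_cmul; [exact: derivable_ccst|exact: derivable_cexpr].
Qed.

Lemma analytic_cexp_scale (s : R) (L : R[i] -> R[i]) :
  analytic_on_disc L -> analytic_on_disc (fun z => cexp (s%:C * L z)).
Proof.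
move=> dL z z1; apply: (@derivable_ccomp _ (fun z => s%:C * L z) (@cexp R)).
  by apply: derivable_cmul; [exact: derivable_ccst|exact: dL].
exact: derivable_cexp.
Qed.

Lemma unit_disc0 : unit_disc (0 : R[i]).
Proof. by rewrite /unit_disc /mkset normc0 ltr01. Qed.

(** As a function of [v = z ^+ N], a branch of [(v + a) ^ s] has derivative
    [s * g 0 / a] at [v = 0]: this is its Taylor coefficient of order [N]. *)
Lemma power_branch_coef N a (s : R) (L : R[i] -> R[i]) (g := fun z => cexp (s%:C * L z)) :
  (1 <= N)%N -> a != 0 -> analytic_on_disc L ->
  (forall z, unit_disc z -> cexp (L z) = z ^+ N + a) ->
  forall e, 0 < e -> exists2 r, 0 < r & forall z, z != 0 -> normc z < r ->
    normc ((g z - g 0) / z ^+ N - s%:C * g 0 / a) < e.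
Proof.
move=> N1 a0 dL LE e e0.
have g0 : 0 < normc (g 0) by rewrite normc_cexp expR_gt0.
have na : 0 < normc a by rewrite normc_gt0.
have L0 : cexp (L 0) = a by rewrite (LE _ unit_disc0); case: (N) N1 => // n _; rewrite exprS mul0r add0r.
pose e' := e * normc a / (2 * normc (g 0)).
have e'0 : 0 < e' by rewrite divr_gt0 ?mulr_gt0.
have [r r0 rP] := cexp_scale_sub1 s e'0.
have [r' r'0 rP'] := derivable_ccont (dL 0 unit_disc0) r0.
exists (Num.min r' 1); first by rewrite lt_min r'0 ltr01.
move=> z z0; rewrite lt_min => /andP[zr z1].
have zN : z ^+ N != 0 by rewrite expf_neq0.
pose w := L z - L 0.
have wr : normc w < r by apply: rP'; rewrite subr0.
have ew : cexp w - 1 = z ^+ N / a.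
  by rewrite /w cexpD cexpN L0 LE//; field.
have gE : g z = g 0 * cexp (s%:C * w).
  by rewrite /g -cexpD; congr cexp; rewrite /w; ring.
have := rP _ wr; rewrite ew => H.
rewrite (_ : _ - _ = g 0 / z ^+ N * (cexp (s%:C * w) - 1 - s%:C * (z ^+ N / a))); last first.
  by rewrite gE; field; rewrite a0.
rewrite normcM.
apply: (@le_lt_trans _ _ (normc (g 0 / z ^+ N) * (e' * normc (z ^+ N / a)))).
  by rewrite ler_wpM2l ?normc_ge0.
rewrite [normc (g 0 / _)]normcM [normc (z ^+ N / a)]normcM !normcV (_ : _ * _ = e / 2); first by rewrite ltr_pdivrMr// ltr_pMr// ltr1n.
have nz : 0 < normc (z ^+ N) by rewrite normc_gt0.
by rewrite /e'; field; rewrite !gt_eqF.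
Qed.

End PowerBranch.

(** * The orthogonality relation *)

Section Orthogonality.
Variable R : realType.
Notation T := (measurableTypeR R).
Notation mu := (@lebesgue_measure R).
Notation mu2 := (mu \x mu)%E.
Implicit Types (f g : R[i] -> R[i]) (z w : R[i]).

Lemma ccontM f g z : ccont f z -> ccont g z -> ccont (fun w => f w * g w) z.
Proof.
move=> cf cg e e0.
have nf := normc_ge0 (f z); have ng := normc_ge0 (g z).
set M := 1 + normc (f z) + normc (g z); have M0 : 0 < M by rewrite /M; lra.
pose d := Num.min 1 (e / M).
have d0 : 0 < d by rewrite lt_min ltr01 divr_gt0.
have dM : d * M <= e by rewrite -ler_pdivlMr// ge_min lexx orbT.
have d1 : d <= 1 by rewrite ge_min lexx.
have [r1 r10 h1] := cf _ d0; have [r2 r20 h2] := cg _ d0.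
exists (Num.min r1 r2); first by rewrite lt_min r10.
move=> w; rewrite lt_min => /andP[/h1 fw /h2 gw].
have -> : f w * g w - f z * g z =
  (f w - f z) * (g w - g z) + f z * (g w - g z) + (f w - f z) * g z by ring.
apply: le_lt_trans (normcD _ _) _.
apply: le_lt_trans (lerD (normcD _ _) (lexx _)) _; rewrite !normcM.
set x := normc (f w - f z) in fw *; set y := normc (g w - g z) in gw *.
have x0 : 0 <= x := normc_ge0 _; have y0 : 0 <= y := normc_ge0 _.
apply: lt_le_trans dM; rewrite /M; nra.
Qed.

Lemma ccontD f g z : ccont f z -> ccont g z -> ccont (fun w => f w + g w) z.
Proof.
move=> cf cg e e0; have e20 : 0 < e / 2 by rewrite divr_gt0.
have [r1 r10 h1] := cf _ e20; have [r2 r20 h2] := cg _ e20.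
exists (Num.min r1 r2); first by rewrite lt_min r10.
move=> w; rewrite lt_min => /andP[/h1 fw /h2 gw].
have -> : f w + g w - (f z + g z) = (f w - f z) + (g w - g z) by ring.
by apply: le_lt_trans (normcD _ _) _; rewrite (splitr e) ltrD.
Qed.

Lemma ccont_cst (c : R[i]) z : ccont (fun=> c) z.
Proof. by move=> e e0; exists 1 => // w _; rewrite subrr normc0. Qed.

Lemma twopi_ge0 : 0 <= pi *+ 2 :> R.
Proof. by rewrite mulrn_wge0// pi_ge0. Qed.

Lemma normc0_pow N : (1 <= N)%N -> normc (0 : R[i]) ^+ 2 ^+ N = 0.
Proof. by case: N => // N _; rewrite normc0 -exprM expr0n. Qed.

Lemma rotate0 t : rotate t (0 : R[i]) = 0.
Proof. exact: mulr0. Qed.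

Lemma conj_expr_normc z N : z != 0 -> conjc (z ^+ N) = (normc z ^+ 2 ^+ N)%:C / z ^+ N.
Proof.
move=> z0; have zN : z ^+ N != 0 by rewrite expf_neq0.
apply: (mulfI zN); rewrite mul_conjc normcX mulrCA divff// mulr1.
by rewrite -!exprM mulnC.
Qed.

Lemma integrable_disc_moment N : mu2.-integrable (@disc R) (fun u => (sqrad u ^+ N)%:E).
Proof.
apply/integrableP; split.
  by apply/measurable_EFinP; apply: measurable_funTS; apply: measurable_funX;
    exact: measurable_sqrad.
under eq_integral do rewrite gee0_abs ?lee_fin ?exprn_ge0 ?sqrad_ge0//.
by rewrite disc_moment ltry.
Qed.

Lemma disc_moment_centred (K : R) N :
  (\int[mu2]_(u in @disc R) (K * (sqrad u ^+ N - N.+1%:R^-1))%:E = 0)%E.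
Proof.
have mD := @measurable_disc R; have iN := integrable_disc_moment N.
have ic : mu2.-integrable (@disc R) (EFin \o (fun=> N.+1%:R^-1)).
  apply/integrableP; split; first exact: measurable_cst.
  rewrite /= integral_cst//= [X in (_ * X)%E](_ : _ = pi%:E); last exact: disc_measure.
  by rewrite -EFinM ltry.
under eq_integral do rewrite EFinM.
rewrite integralZl//; last first.
  by under eq_fun do rewrite EFinB; exact: integrableB.
under eq_integral do rewrite EFinB.
rewrite integralB//= disc_moment integral_cst//.
rewrite [X in (_ - _ * X)%E](_ : _ = pi%:E); last exact: disc_measure.
by rewrite -(EFinM N.+1%:R^-1) -EFinB (mulrC N.+1%:R^-1) subrr mule0.
Qed.

(** Let [l] be the coefficient of order [N] of [g], whose coefficients of orders
    [1 .. N - 1] vanish. The pairing of [f * g] with [z ^+ N + conj alpha] is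
    then [(f_N * g 0 + f_0 * l) / (N + 1) + f_0 * g 0 * alpha], which by the
    equation on [alpha], [beta] and [l] is [g 0] times the pairing of [f] with
    [z ^+ N + conj beta]. In the difference [H] the coefficient [f_N] cancels, and
    the mean of [H] over [|z| = r] is [Re (f_0 * l) * (r ^ (2 * N) - 1 / (N + 1))].
    Integrability is asked of [H] as a whole, since the terms in [f * g] alone may
    fail to be integrable. *)
Lemma pairing_shift N f g (alpha beta l : R[i])
    (H := fun z => complex.Re (f z * (g z * (conjc (z ^+ N) + alpha) -
                                      g 0 * (conjc (z ^+ N) + beta)))) :
  (1 <= N)%N -> analytic_on_disc f -> analytic_on_disc g ->
  (forall e, 0 < e -> exists2 r, 0 < r & forall z, z != 0 -> normc z < r ->
     normc ((g z - g 0) / z ^+ N - l) < e) ->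
  l / N.+1%:R + g 0 * alpha = g 0 * beta ->
  mu2.-integrable (@disc R) (fun u => (H (of_plane u))%:E) ->
  (\int[mu2]_(u in @disc R) (H (of_plane u))%:E = 0)%E.
Proof.
move=> N1 df dg gl eqn Hi.
pose K := complex.Re (f 0 * l).
pose m z := K * (normc z ^+ 2 ^+ N - N.+1%:R^-1).
have NC : (N.+1%:R^-1 : R)%:C = N.+1%:R^-1 :> R[i] by rewrite fmorphV rmorph_nat.
rewrite (disc_average (m := m) Hi); last first.
  clear Hi => z z1; have [->|z0] := eqVneq z 0.
    have HE : (fun t => H (rotate t 0)) = fun=> H 0.
      by apply/funext => t; rewrite rotate0.
    rewrite HE; split; first exact: seg_cont_cst.
    rewrite (sint_cst _ twopi_ge0) subr0; congr (_ * _).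
    rewrite /H /m (normc0_pow N1) sub0r.
    rewrite [f 0 * _](_ : _ = (- N.+1%:R^-1)%:C * (f 0 * l)).
      by rewrite ReZ mulrC.
    rewrite rmorphN /= NC.
    rewrite [g 0 * _ - _](_ : _ = g 0 * alpha - g 0 * beta); last by ring.
    by rewrite -eqn; ring.
  pose r2 := normc z ^+ 2 ^+ N.
  pose k w := r2%:C * (f w * ((g w - g 0) / w ^+ N)) + f w * (g w * alpha - g 0 * beta).
  have kH t : H (rotate t z) = complex.Re (k (rotate t z)).
    have rz0 : rotate t z != 0 by rewrite -normc_gt0 normc_rotate normc_gt0.
    rewrite /H /k conj_expr_normc// normc_rotate -/r2; congr complex.Re.
    by ring.
  have -> : (fun t => H (rotate t z)) = fun t => complex.Re (k (rotate t z)).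
    by apply/funext => t.
  have -> : m z = complex.Re (f 0 * l * (r2 - N.+1%:R^-1)%:C).
    by rewrite mulrC ReZ mulrC.
  have in_disc w : normc w <= normc z -> unit_disc w.
    by move=> wz; rewrite /unit_disc /mkset (le_lt_trans wz).
  apply: (circle_mean z0) => [w w0 wz|].
    have [dfw dgw] := (df _ (in_disc _ wz), dg _ (in_disc _ wz)).
    have dc := @derivable_ccst R.
    apply: derivable_cadd.
      apply: derivable_cmul; first exact: dc.
      apply: derivable_cmul; first exact: dfw.
      apply: derivable_cmul; first by apply: derivable_cadd; [exact: dgw|exact: dc].
      apply: derivable_cinv; first by rewrite expf_neq0.
      exact: derivable_cexpr.
    apply: derivable_cmul; first exact: dfw.
    apply: derivable_cadd; last exact: dc.
    by apply: derivable_cmul; [exact: dgw|exact: dc].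
  (* The quotient, completed by its limit, so that the limit of [k] follows from
     continuity at [0]. *)
  pose q w := if w == 0 then l else (g w - g 0) / w ^+ N.
  have cq : ccont q 0.
    move=> e e0; have [r r0 rP] := gl _ e0; exists r => // w; rewrite subr0 => wr.
    rewrite /q eqxx; case: eqVneq => [_|w0]; last exact: rP.
    by rewrite subrr normc0.
  have cf := derivable_ccont (df 0 (@unit_disc0 R)).
  have cg := derivable_ccont (dg 0 (@unit_disc0 R)).
  have : ccont (fun w => r2%:C * (f w * q w) + f w * (g w * alpha - g 0 * beta)) 0.
    apply: ccontD; first by apply: ccontM; [exact: ccont_cst|exact: ccontM].
    apply: ccontM => //; apply: ccontD; last exact: ccont_cst.
    by apply: ccontM => //; exact: ccont_cst.
  move=> ck e e0; have [r r0 rP] := ck _ e0; exists r => // w w0 wr.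
  have := rP w; rewrite subr0 => /(_ wr); rewrite /q eqxx (negbTE w0).
  congr (normc (_ - _) < _); rewrite -eqn rmorphB /= NC.
  by ring.
rewrite -[RHS](disc_moment_centred K N); apply: eq_integral => u _.
by rewrite /m sqradE.
Qed.

End Orthogonality.

(** * Integrable functions on the disc *)

Section DiscIntegral.
Variable R : realType.
Notation T := (measurableTypeR R).
Notation mu := (@lebesgue_measure R).
Notation mu2 := (mu \x mu)%E.
Implicit Types (f g k F : R[i] -> R[i]) (u v : R[i] -> R) (z : R[i]) (p : R).

Definition dintegrable u :=
  (sigma R).-integrable (@disc R) (EFin \o (u \o @of_plane R)).

Definition dint u : R := \int[sigma R]_(x in @disc R) u (of_plane x).

Definition dmeasurable u := measurable_fun (@disc R) (u \o @of_plane R).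

Lemma EFin_dint u : dintegrable u ->
  (\int[sigma R]_(x in @disc R) (u (of_plane x))%:E = (dint u)%:E)%E.
Proof.
move=> ui; rewrite /dint /Rintegral fineK//.
by apply: integrable_fin_num => //; exact: measurable_disc.
Qed.

Lemma dintD u v : dintegrable u -> dintegrable v ->
  dintegrable (fun z => u z + v z) /\ dint (fun z => u z + v z) = dint u + dint v.
Proof.
move=> ui vi; have mD := @measurable_disc R; split.
  have := integrableD mD ui vi; apply: eq_integrable => //.
exact: RintegralD.
Qed.

Lemma dintZ (c : R) u : dintegrable u ->
  dintegrable (fun z => c * u z) /\ dint (fun z => c * u z) = c * dint u.
Proof.
move=> ui; have mD := @measurable_disc R; split.
  have := integrableZl mD c ui; apply: eq_integrable => //.
exact: RintegralZl.
Qed.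

Lemma dintB u v : dintegrable u -> dintegrable v ->
  dintegrable (fun z => u z - v z) /\ dint (fun z => u z - v z) = dint u - dint v.
Proof.
move=> ui vi; have mD := @measurable_disc R; split.
  have := integrableB mD ui vi; apply: eq_integrable => //.
exact: RintegralB.
Qed.

Lemma eq_dint u v : (forall z, unit_disc z -> u z = v z) -> dint u = dint v.
Proof. by move=> uv; apply: eq_Rintegral => x /set_mem; exact: uv. Qed.

Lemma dint_mu2 u : dintegrable u ->
  (\int[mu2]_(x in @disc R) (u (of_plane x))%:E = (pi * dint u)%:E)%E.
Proof.
move=> ui; have := EFin_dint ui; rewrite sigma_integral//; last exact: measurable_disc.
rewrite EFinM => <-; rewrite muleA -EFinM divff ?mul1e//.
by rewrite gt_eqF// pi_gt0.
Qed.

Lemma dintegrable_mu2 u : dintegrable u ->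
  mu2.-integrable (@disc R) (fun x => (u (of_plane x))%:E).
Proof. by move/(sigma_integrableP _ (@measurable_disc R)). Qed.

Lemma dintegrable_le u v : dmeasurable u -> dintegrable v ->
  (forall z, unit_disc z -> `|u z| <= v z) -> dintegrable u.
Proof.
move=> mu_ vi uv; have mD := @measurable_disc R.
have mEu : measurable_fun (@disc R) (EFin \o (u \o @of_plane R)).
  exact/measurable_EFinP.
apply: (le_integrable mD mEu _ vi) => x Dx.
by rewrite /= lee_fin (le_trans (uv _ Dx))// ler_norm.
Qed.

Lemma dintegrable_cst (c : R) : dintegrable (fun=> c).
Proof.
apply/(sigma_integrableP _ (@measurable_disc R))/integrableP; split.
  by apply/measurable_EFinP; exact: (@measurable_cst _ _ _ _ (@disc R) c).
rewrite /= integral_cst//=; last exact: measurable_disc.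
rewrite [X in (_ * X)%E](_ : _ = pi%:E); last exact: disc_measure.
by rewrite -EFinM ltry.
Qed.

Lemma ccont_dmeasurable_Re f : (forall z, unit_disc z -> ccont f z) ->
  dmeasurable (fun z => complex.Re (f z)).
Proof.
move=> cf; apply: disc_continuous_measurable => z z1; apply/rcontP => e e0.
have [r r0 rP] := cf _ z1 _ e0; exists r => // w /rP; apply: le_lt_trans.
by rewrite -ReB normc_Re.
Qed.

Lemma ccont_dmeasurable_powR f p : (forall z, unit_disc z -> ccont f z) ->
  dmeasurable (fun z => normc (f z) `^ p).
Proof.
move=> cf; have mn : dmeasurable (fun z => normc (f z)).
  apply: disc_continuous_measurable => z z1; apply/rcontP => e e0.
  have [r r0 rP] := cf _ z1 _ e0; exists r => // w /rP; apply: le_lt_trans.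
  exact: normc_dist.
have := measurableT_comp (@measurable_powR R p) mn; exact.
Qed.

Lemma analytic_ccont f z : analytic_on_disc f -> unit_disc z -> ccont f z.
Proof. by move=> df /df/derivable_ccont. Qed.

Lemma ccont_conj k z : ccont k z -> ccont (fun w => conjc (k w)) z.
Proof.
move=> ck e /ck[r r0 rP]; exists r => // w /rP; congr (_ < _).
by rewrite -rmorphB normc_conj.
Qed.

Lemma bergman_integrable p f : 0 < p -> bergman_space p f ->
  dintegrable (fun z => normc (f z) `^ p).
Proof.
move=> p0 [df nf]; apply/integrableP; split.
  apply/measurable_EFinP; apply: ccont_dmeasurable_powR => z.
  exact: analytic_ccont.
move: nf; rewrite /bergman_norm => /lty_poweRy; rewrite invr_neq0 ?gt_eqF// => /(_ isT).
apply: le_lt_trans; rewrite le_eqVlt; apply/orP; left; apply/eqP.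
by apply: eq_integral => x _; rewrite /= ger0_norm// powR_ge0.
Qed.

Lemma bergman_norm1P p f : 0 < p -> bergman_space p f ->
  bergman_norm p f = 1%E <-> dint (fun z => normc (f z) `^ p) = 1.
Proof.
move=> p0 bf; have fi := bergman_integrable p0 bf.
have -> : bergman_norm p f = ((dint (fun z => normc (f z) `^ p))%:E `^ p^-1)%E.
  by rewrite -EFin_dint.
have d0 : 0 <= dint (fun z => normc (f z) `^ p).
  by apply: Rintegral_ge0 => x _; exact: powR_ge0.
rewrite poweR_EFin; split=> [[]/eqP|->]; last by rewrite powR1.
by rewrite powR_eq1 ltNge d0/= invr_eq0 (gt_eqF p0) orbF => /eqP.
Qed.

(** A non-negative function with zero integral vanishes almost everywhere, hence
    cannot be positive on a non-empty open set. *)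
Lemma dint0_open (P : set R[i]) u : dintegrable u ->
  (forall z, unit_disc z -> 0 <= u z) -> dint u = 0 ->
  (forall z, P z -> unit_disc z /\ 0 < u z) ->
  (forall z, P z -> exists2 r, 0 < r & forall w, normc (w - z) < r -> P w) ->
  forall z, ~ P z.
Proof.
move=> ui u0 iu0 Pu oP z Pz; have mD := @measurable_disc R.
have mu_ : measurable_fun (@disc R) (EFin \o (u \o @of_plane R)).
  by have /integrableP[] := ui.
have /(ae_eq_integral_abs _ mD mu_)[A [mA A0 BA]] :
    (\int[sigma R]_(x in @disc R) `|(EFin \o (u \o @of_plane R)) x| = 0)%E.
  transitivity (dint u)%:E; last by rewrite iu0.
  rewrite -EFin_dint//; apply: eq_integral => x /set_mem Dx.
  by rewrite /= ger0_norm// u0.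
have [r r0 rP] := oP _ Pz; pose x0 := complex.Re z; pose y0 := complex.Im z.
pose Q : set (T * T) := `]x0, x0 + r / 2[%classic `*` `]y0, y0 + r / 2[%classic.
have QA : Q `<=` A.
  move=> [x y] [/=]; rewrite !in_itv/= => /andP[x1 x2] /andP[y1 y2].
  apply: BA => /=; have [D1 u1] : unit_disc (of_plane (x, y)) /\ 0 < u (of_plane (x, y)).
    apply: Pu; apply: rP; apply: le_lt_trans (normc_le_ReIm _) _.
    rewrite ReB ImB /= (splitr r) ltrD// ltr_norml; apply/andP; split; lra.
  by move=> /(_ D1) [] u2; rewrite u2 ltxx in u1.
have mQ : measurable Q by exact: measurableX.
have : (sigma R Q <= sigma R A)%E by apply: le_measure; rewrite ?inE.
have Qpos : (0 < mu2 Q)%E.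
  rewrite [ltRHS](product_measure1E mu mu)//= !lebesgue_measure_itv/= !lte_fin.
  rewrite !ltrDl !divr_gt0// -!EFinB -EFinM lte_fin.
  by rewrite ![_ + _ - _]addrC !addKr mulr_gt0// divr_gt0.
rewrite A0 leNgt => /negP; apply.
by rewrite /sigma /= /mscale /= mul1r mule_gt0// lte_fin invr_gt0 pi_gt0.
Qed.

End DiscIntegral.

(** * Duality criterion for extremal functions *)

Section ExtremalCriterion.
Variable R : realType.
Implicit Types (f g k F G : R[i] -> R[i]) (z : R[i]) (p : R).

(** The dual function [|F| ^ (p - 2) * conj F] of [F]. *)
Definition dual_fun p F z : R[i] := (normc (F z) `^ p)%:C / F z.

(** A form of Young's inequality: it makes the pairing with the dual function
    integrable. *)
Lemma normc_dual_mul p F f z : 1 < p -> F z != 0 ->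
  normc (dual_fun p F z * f z) <= normc (F z) `^ p + normc (f z) `^ p.
Proof.
move=> p1 F0; have nF : 0 < normc (F z) by rewrite normc_gt0.
set t := normc (f z) / normc (F z).
have t0 : 0 <= t by rewrite divr_ge0 ?normc_ge0.
have V0 : 0 < normc (F z) `^ p by exact: powR_gt0.
have -> : normc (f z) = normc (F z) * t by rewrite /t mulrC divfK ?gt_eqF.
rewrite powRM ?normc_ge0// normcM normcM normcV normc_real ger0_norm ?powR_ge0//.
have -> : normc (F z) `^ p / normc (F z) * normc (f z) = normc (F z) `^ p * t.
  by rewrite /t mulrAC mulrA.
rewrite -{2}[normc (F z) `^ p]mulr1 -mulrDr ler_pM2l//.
have [h _] := powR_tangent p1 t0; have [t1|t1] := leP t 1.
  by rewrite (le_trans t1)// lerDl powR_ge0.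
have tp : t <= 1 + p * (t - 1) by nra.
by lra.
Qed.

Lemma kernel_functional_Re k g :
  complex.Re (kernel_functional k g) = dint (fun z => complex.Re (g z * conjc (k z))).
Proof. by []. Qed.

(** Duality criterion: if, up to a positive factor, the functional is integration
    against the dual function of [F], then the tangent inequality of [|w| ^ p]
    along [F], integrated over the disc, bounds the functional on the unit
    sphere by its value at [F], with equality only for [F] itself. *)
Lemma extremal_criterion p k F (C : R) : 1 < p -> 0 < C ->
  bergman_space p F -> bergman_norm p F = 1%E ->
  (forall z, unit_disc z -> F z != 0) ->
  (forall g, bergman_space p g ->
     dintegrable (fun z => complex.Re (dual_fun p F z * g z)) /\
     dint (fun z => complex.Re (dual_fun p F z * g z)) =
       C * complex.Re (kernel_functional k g)) ->
  is_unique_extremal p k F.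
Proof.
move=> p1 C0 bF nF F0 dual; have p0 : 0 < p by exact: lt_trans p1.
pose V z := normc (F z) `^ p.
(* The gap in the tangent inequality. *)
pose D g z := normc (g z) `^ p - V z - p * (complex.Re (dual_fun p F z * g z) - V z).
have iV : dintegrable V by exact: bergman_integrable.
have V1 : dint V = 1 by apply/(bergman_norm1P p0 bF).
have tang g z : unit_disc z -> 0 <= D g z /\ (D g z = 0 -> g z = F z).
  move=> z1; have [h1 h2] := normc_powR_tangent (g z) p1 (F0 z z1).
  move: h1 h2; rewrite -/(dual_fun p F z) -/(V z) => h1 h2; split; first by rewrite /D; lra.
  by move=> D0; apply/eqP; rewrite -h2; apply/eqP; move: D0; rewrite /D; lra.
have intD g : bergman_space p g -> bergman_norm p g = 1%E ->
    dintegrable (D g) /\ dint (D g) = p * (1 - C * complex.Re (kernel_functional k g)).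
  move=> bg ng; have [ir er] := dual g bg.
  have ig := bergman_integrable p0 bg.
  have g1 := (bergman_norm1P p0 bg).1 ng.
  have [i1 e1] := dintB ig iV; have [i2 e2] := dintB ir iV.
  have [i3 e3] := dintZ p i2; have [i4 e4] := dintB i1 i3.
  by split; [exact: i4|rewrite [LHS]e4 e1 e3 e2 er g1 V1; ring].
have upper g : bergman_space p g -> bergman_norm p g = 1%E ->
    complex.Re (kernel_functional k g) <= C^-1.
  move=> bg ng; have [ig eg] := intD g bg ng.
  have : 0 <= dint (D g) by apply: Rintegral_ge0 => x Dx; have [] := tang g _ Dx.
  by rewrite eg pmulr_rge0// subr_ge0 -ler_pdivlMl// mulr1.
have FC : complex.Re (kernel_functional k F) = C^-1.
  apply: (mulfI (lt0r_neq0 C0)); rewrite divff ?gt_eqF// -(dual F bF).2 -V1.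
  apply: eq_dint => z z1; rewrite /dual_fun divfK ?F0//.
have supE : ereal_sup [set (complex.Re (kernel_functional k g))%:E
    | g in [set g | bergman_space p g /\ bergman_norm p g = 1%E]] = (C^-1)%:E.
  apply/eqP; rewrite eq_le; apply/andP; split.
    by apply: ge_ereal_sup => _ [g [bg ng] <-]; rewrite lee_fin upper.
  by apply: ereal_sup_ubound; exists F => //; rewrite FC.
split; first by split => //; rewrite supE FC.
move=> G [bG nG]; rewrite supE => /eqP; rewrite eqe => /eqP GC z z1; apply: contrapT => GF.
have [iG eG] := intD G bG nG.
have DG0 : dint (D G) = 0 by rewrite eG GC divff ?gt_eqF// subrr mulr0.
pose P := [set w | unit_disc w /\ G w <> F w].
apply: (@dint0_open R P (D G) iG _ DG0 _ _ z) => //.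
- by move=> w w1; have [] := tang G w w1.
- move=> w [w1 GFw]; split => //; have [D0 Deq] := tang G w w1.
  by rewrite lt_neqAle D0 andbT eq_sym; apply/eqP => /Deq.
- move=> w [w1 /eqP GFw].
  have cG := analytic_ccont bG.1 w1; have cF := analytic_ccont bF.1 w1.
  have d0 : 0 < normc (G w - F w) / 2 by rewrite divr_gt0// normc_gt0 subr_eq0.
  have [r1 r10 h1] := cG _ d0; have [r2 r20 h2] := cF _ d0.
  have [r3 r30 h3] := unit_disc_open w1.
  exists (Num.min r1 (Num.min r2 r3)); first by rewrite !lt_min r10 r20.
  move=> v; rewrite !lt_min => /and3P[/h1 Gv /h2 Fv /h3 v1]; split => // GFv.
  have : normc (G w - F w) <= normc (G w - G v) + normc (F v - F w).
    apply: le_trans (normcD _ _); rewrite GFv le_eqVlt; apply/orP; left.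
    by apply/eqP; congr normc; ring.
  by have := normcB_sym (G w) (G v); lra.
Qed.

End ExtremalCriterion.

(** * The kernel and its norm *)

Section KernelComputations.
Variable R : realType.
Notation T := (measurableTypeR R).
Notation mu := (@lebesgue_measure R).
Notation mu2 := (mu \x mu)%E.
Implicit Types (f g h k F : R[i] -> R[i]) (z : R[i]) (p : R).

Lemma eq_dintegrable (u v : R[i] -> R) : (forall z, unit_disc z -> u z = v z) ->
  dintegrable u -> dintegrable v.
Proof.
move=> uv; apply: eq_integrable; first exact: measurable_disc.
by move=> x /set_mem Dx; rewrite /= uv.
Qed.

Lemma analytic_congr f g : (forall z, unit_disc z -> f z = g z) ->
  analytic_on_disc g -> analytic_on_disc f.
Proof.
move=> fg dg z z1; have /derivable_cderivP[d dd] := dg z z1.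
apply/derivable_cderivP; exists d => e e0.
have [r r0 rP] := dd _ e0; have [r' r'0 rP'] := unit_disc_open z1.
exists (Num.min r r'); first by rewrite lt_min r0.
move=> h; rewrite lt_min => /andP[hr hr']; rewrite !fg//; first exact: rP.
by apply: rP'; rewrite addrC addKr.
Qed.

Lemma dint_moment N :
  dintegrable (fun z : R[i] => normc z ^+ 2 ^+ N) /\
  dint (fun z : R[i] => normc z ^+ 2 ^+ N) = N.+1%:R^-1.
Proof.
have iN : dintegrable (fun z : R[i] => normc z ^+ 2 ^+ N).
  apply/(sigma_integrableP _ (@measurable_disc R)).
  apply: eq_integrable (integrable_disc_moment R N); first exact: measurable_disc.
  by move=> x _; rewrite /= sqradE.
split => //; have := dint_mu2 iN.
under eq_integral do rewrite -sqradE.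
rewrite disc_moment => /eqP; rewrite eqe => /eqP H.
by apply: (mulfI (lt0r_neq0 (pi_gt0 R))); rewrite -H.
Qed.

Lemma dint_cst (c : R) : dint (fun=> c) = c.
Proof.
have [i0 e0] := dint_moment 0; rewrite invr1 in e0.
rewrite -[RHS]mulr1 -e0 -(dintZ c i0).2; apply: eq_dint => z _.
by rewrite expr0 mulr1.
Qed.

Lemma ccont_expr_add N (a : R[i]) z : ccont (fun w => w ^+ N + a) z.
Proof.
apply: ccontD; last exact: ccont_cst.
by apply: derivable_ccont; exact: derivable_cexpr.
Qed.

Lemma normc_kernel_le N (a : R[i]) z : unit_disc z -> normc (z ^+ N + a) <= 1 + normc a.
Proof.
move=> z1; apply: le_trans (normcD _ _) _; rewrite lerD2r normcX exprn_ile1//.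
  exact: normc_ge0.
exact: ltW.
Qed.

(** On a circle the cross term [2 * Re (conj a * z ^+ N)] has mean [0]. *)
Lemma dint_kernel_sqr N (a : R[i]) : (1 <= N)%N ->
  dintegrable (fun z => normc (z ^+ N + a) ^+ 2) /\
  dint (fun z => normc (z ^+ N + a) ^+ 2) = normc a ^+ 2 + N.+1%:R^-1.
Proof.
move=> N1; pose H z := normc (z ^+ N + a) ^+ 2.
have HR : H = fun z => complex.Re ((z ^+ N + a) * conjc (z ^+ N + a)).
  by apply/funext => z; rewrite mul_conjc.
have iH : dintegrable H.
  apply: (dintegrable_le _ (dintegrable_cst ((1 + normc a) ^+ 2))).
    rewrite HR; apply: ccont_dmeasurable_Re => z _; apply: ccontM.
      exact: ccont_expr_add.
    by apply: ccont_conj; exact: ccont_expr_add.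
  move=> z z1; rewrite ger0_norm ?sqr_ge0// ler_sqr ?nnegrE ?normc_ge0//.
    exact: normc_kernel_le.
  by rewrite addr_ge0// normc_ge0.
pose m z := normc z ^+ 2 ^+ N + normc a ^+ 2.
have [iN eN] := dint_moment N.
have [im em] := dintD iN (dintegrable_cst (normc a ^+ 2)).
rewrite eN dint_cst addrC in em; rewrite -em; split => //.
apply: (mulfI (lt0r_neq0 (pi_gt0 R))); apply/eqP; rewrite -eqe; apply/eqP.
rewrite -!dint_mu2//; apply: (@disc_average R H m); first exact: dintegrable_mu2.
move=> z z1; have [->|z0] := eqVneq z 0.
  have -> : (fun t => H (rotate t 0)) = fun=> H 0 by apply/funext => t; rewrite rotate0.
  split; first exact: seg_cont_cst.
  rewrite (sint_cst _ (twopi_ge0 R)) subr0 /m (normc0_pow R N1) add0r /H.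
  by case: (N) N1 => // n _; rewrite [0 ^+ n.+1]exprS mul0r add0r.
pose r2 := normc z ^+ 2 ^+ N.
pose k w := (r2 + normc a ^+ 2)%:C + (2%:C * conjc a) * w ^+ N.
have kH t : H (rotate t z) = complex.Re (k (rotate t z)).
  have wE : normc (rotate t z ^+ N) ^+ 2 = r2.
    by rewrite normcX normc_rotate /r2 -!exprM mulnC.
  rewrite /H /k ReD /= -wE !sqr_normcE; case: (rotate t z ^+ N) => x y; case: (a) => c d.
  by rewrite /=; simpc => /=; ring.
have -> : (fun t => H (rotate t z)) = fun t => complex.Re (k (rotate t z)).
  by apply/funext.
have -> : m z = complex.Re ((r2 + normc a ^+ 2)%:C : R[i]) by [].
have dk w : derivable (k : R[i]^o -> R[i]^o) w 1.
  apply: derivable_cadd; first exact: derivable_ccst.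
  by apply: derivable_cmul; [exact: derivable_ccst|exact: derivable_cexpr].
apply: (circle_mean z0) => [w _ _|e e0]; first exact: dk.
have [r r0 rP] := derivable_ccont (dk 0) e0; exists r => // w _ wr.
have := rP w; rewrite subr0 => /(_ wr); congr (normc (_ - _) < _).
by rewrite /k; case: (N) N1 => // n _; rewrite [0 ^+ n.+1]exprS mul0r mulr0 addr0.
Qed.

Lemma bergman_mul_bounded p f k (M : R) : 1 < p -> bergman_space p f ->
  (forall z, unit_disc z -> ccont k z) ->
  (forall z, unit_disc z -> normc (k z) <= M) ->
  dintegrable (fun z => complex.Re (f z * k z)).
Proof.
move=> p1 bf ck kM; have p0 : 0 < p by exact: lt_trans p1.
have M0 : 0 <= M := le_trans (normc_ge0 _) (kM 0 (@unit_disc0 R)).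
have [i1 _] := dintD (dintegrable_cst 1) (bergman_integrable p0 bf).
have [i2 _] := dintZ M i1.
apply: (dintegrable_le _ i2).
  apply: ccont_dmeasurable_Re => z z1; apply: ccontM; last exact: ck.
  exact: analytic_ccont bf.1 z1.
move=> z z1; apply: le_trans (normc_Re _) _; rewrite normcM mulrC.
apply: ler_pM; rewrite ?normc_ge0// ?kM//.
have [x1|x1] := leP (normc (f z)) 1; first by rewrite (le_trans x1)// lerDl powR_ge0.
have [h _] := powR_tangent p1 (normc_ge0 (f z)).
have xp : normc (f z) <= 1 + p * (normc (f z) - 1) by nra.
by lra.
Qed.

End KernelComputations.

(** * The extremal function *)

Section PowerExtremal.
Variables (R : realType) (N : nat) (p : R) (a b : R[i]).
Hypotheses (N1 : (1 <= N)%N) (p1 : 1 < p) (a1 : 1 <= normc a).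
Hypothesis abE : conjc b = conjc a + (N.+1%:R^-1 * (1 - 2 / p))%:C / a.
Variables (L h : R[i] -> R[i]).
Hypotheses (dL : analytic_on_disc L)
  (LE : forall z, unit_disc z -> cexp (L z) = z ^+ N + a)
  (hE : forall z, unit_disc z -> h z = cexp ((2 / p)%:C * L z)).

(** [g] is the complementary power, [g * h = z ^+ N + a], and the unimodular
    factor [lambda] of [F] is the sign of [g 0]. *)
Let s := 1 - 2 / p.
Let A := normc a ^+ 2 + 1 / N.+1%:R.
Let K := A `^ (1 / p).
Let g z := cexp (s%:C * L z).
Let lambda := csgn (a / h 0).
Let F z := lambda * (h z / K%:C).

Let p0 : 0 < p. Proof. exact: lt_trans p1. Qed.

Let a0 : a != 0. Proof. by rewrite -normc_gt0 (lt_le_trans ltr01). Qed.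

Let A0 : 0 < A.
Proof.
have a1sq : 1 <= normc a ^+ 2 by rewrite -[1](expr1n R 2) ler_sqr ?nnegrE ?normc_ge0.
by rewrite /A ltr_pwDl ?divr_ge0// (lt_le_trans ltr01).
Qed.

Let K0 : 0 < K. Proof. exact: powR_gt0. Qed.

Let KC0 : K%:C != 0 :> R[i].
Proof. by rewrite (inj_eq (@complexI R) _ 0) gt_eqF. Qed.

Let KpE : K `^ p = A.
Proof. by rewrite /K -powRrM mul1r mulVf ?gt_eqF// powRr1// ltW. Qed.

Let h_neq0 z : unit_disc z -> h z != 0.
Proof. by move=> z1; rewrite hE// cexp_neq0. Qed.

Let ghE z : unit_disc z -> g z * h z = z ^+ N + a.
Proof.
move=> z1; rewrite hE// -cexpD -LE//; congr cexp.
have e1 : s%:C + (2 / p)%:C = 1 :> R[i] by rewrite -rmorphD /s subrK.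
by rewrite -mulrDl e1 mul1r.
Qed.

Let g0E : g 0 = a / h 0.
Proof.
have h0 := h_neq0 (@unit_disc0 R).
apply: (mulIf h0); rewrite (ghE (@unit_disc0 R)) divfK//.
by case: (N) N1 => // n _; rewrite [0 ^+ n.+1]exprS mul0r add0r.
Qed.

Let g0_gt0 : 0 < normc (g 0).
Proof. by rewrite normc_cexp expR_gt0. Qed.

Let normc_lambda : normc lambda = 1.
Proof.
rewrite /lambda -g0E /csgn normcM normcV normc_real ger0_norm ?normc_ge0//.
by rewrite divff// gt_eqF.
Qed.

Let lambda0 : lambda != 0.
Proof. by rewrite -normc_gt0 normc_lambda. Qed.

Let g0_lambda : g 0 / lambda = (normc (g 0))%:C.
Proof.
apply: (mulIf lambda0); rewrite divfK// /lambda -g0E /csgn mulrC divfK//.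
by rewrite (inj_eq (@complexI R) _ 0) gt_eqF.
Qed.

Let F_neq0 z : unit_disc z -> F z != 0.
Proof. by move=> /h_neq0 h0; rewrite mulf_neq0// mulf_neq0// invr_neq0. Qed.

Let normc_F z : unit_disc z -> normc (F z) `^ p = normc (z ^+ N + a) ^+ 2 / A.
Proof.
move=> z1; rewrite /F normcM normc_lambda mul1r normcM normcV normc_real (gtr0_norm K0).
rewrite powRM ?normc_ge0 ?invr_ge0 ?(ltW K0)// -powR_inv1 ?(ltW K0)//.
rewrite powRAC KpE powR_inv1 ?(ltW A0)//; congr (_ / _).
rewrite hE// normc_cexp ReZ -expRM -LE// normc_cexp -expRM_natl; congr expR.
by field; rewrite gt_eqF.
Qed.

Let bergman_F : bergman_space p F /\ bergman_norm p F = 1%E.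
Proof.
have dF : analytic_on_disc F.
  apply: (@analytic_congr _ F (fun z => lambda * (cexp ((2 / p)%:C * L z) * (K%:C)^-1))).
    by move=> z z1; rewrite /F hE.
  move=> z z1; apply: derivable_cmul; first exact: derivable_ccst.
  apply: derivable_cmul; last exact: derivable_ccst.
  exact: analytic_cexp_scale.
have [i1 e1] := dint_kernel_sqr a N1; have [i2 e2] := dintZ A^-1 i1.
have FE z : unit_disc z -> A^-1 * normc (z ^+ N + a) ^+ 2 = normc (F z) `^ p.
  by move=> z1; rewrite normc_F// mulrC.
have iF := eq_dintegrable FE i2.
have bF : bergman_space p F.
  split=> //; rewrite /bergman_norm [X in (X `^ _)%E](_ : _ =
    (dint (fun z => normc (F z) `^ p))%:E); last by rewrite -EFin_dint.
  by rewrite poweR_EFin ltry.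
split=> //; apply/(bergman_norm1P p0 bF).
rewrite -(eq_dint FE) e2 e1 /A div1r mulVf// gt_eqF//.
by rewrite -[_^-1]div1r.
Qed.

Let dualE f z : unit_disc z ->
  dual_fun p F z * f z = (K / A)%:C * (conjc (z ^+ N + a) * g z / lambda * f z).
Proof.
move=> z1; rewrite /dual_fun normc_F// /F.
have -> : (normc (z ^+ N + a) ^+ 2 / A)%:C = (z ^+ N + a) * conjc (z ^+ N + a) / A%:C.
  by rewrite mul_conjc -fmorph_div.
rewrite -{1}ghE//.
have -> : (K / A)%:C = K%:C / A%:C :> R[i] by rewrite -fmorph_div.
have AC0 : A%:C != 0 :> R[i] by rewrite (inj_eq (@complexI R) _ 0) gt_eqF.
by field; rewrite h_neq0// lambda0 AC0 KC0.
Qed.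

(** The equation [abE] relating [a] and [b] is what trades the pairing with
    [g * conj (z ^+ N + a)] for the one with [conj (z ^+ N + b)]. *)
Let dual_pairing f : bergman_space p f ->
  dintegrable (fun z => complex.Re (dual_fun p F z * f z)) /\
  dint (fun z => complex.Re (dual_fun p F z * f z)) =
    (K / A * normc (g 0)) * complex.Re (kernel_functional (fun z => z ^+ N + b) f).
Proof.
move=> bf; have [bF _] := bergman_F.
pose E z := (K / A)%:C * (conjc (z ^+ N + a) * g z / lambda * f z).
have dg : analytic_on_disc g by exact: analytic_cexp_scale.
have iE : dintegrable (fun z => complex.Re (E z)).
  have [i1 _] := dintD (bergman_integrable p0 bF) (bergman_integrable p0 bf).
  apply: (dintegrable_le _ i1) => [|z z1].
    apply: ccont_dmeasurable_Re => z z1; apply: ccontM; first exact: ccont_cst.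
    apply: ccontM; last exact: analytic_ccont bf.1 z1.
    apply: ccontM; last exact: ccont_cst.
    apply: ccontM; last exact: analytic_ccont dg z1.
    by apply: ccont_conj; exact: ccont_expr_add.
  apply: le_trans (normc_Re _) _; rewrite /E -dualE//.
  by apply: normc_dual_mul => //; exact: F_neq0.
have EE z : unit_disc z -> complex.Re (E z) = complex.Re (dual_fun p F z * f z).
  by move=> z1; rewrite dualE.
rewrite kernel_functional_Re -(eq_dint EE); split; first exact: eq_dintegrable EE iE.
have ik : dintegrable (fun z => complex.Re (f z * conjc (z ^+ N + b))).
  apply: (bergman_mul_bounded (M := 1 + normc b) p1 bf) => z z1.
    by apply: ccont_conj; exact: ccont_expr_add.
  by rewrite normc_conj normc_kernel_le.
set C := K / A * normc (g 0).
have [ick eck] := dintZ C ik; have [id ed] := dintB iE ick.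
pose f1 z := f z / lambda.
pose H z := complex.Re (f1 z * (g z * (conjc (z ^+ N) + conjc a) -
                                g 0 * (conjc (z ^+ N) + conjc b))).
have KA0 : K / A != 0 by rewrite mulf_neq0 ?invr_eq0 ?gt_eqF.
(* [g 0 / lambda] is the positive number [|g 0|]. *)
have HE z : complex.Re (E z) - C * complex.Re (f z * conjc (z ^+ N + b)) = K / A * H z.
  rewrite /H -!ReZ -ReB; congr complex.Re; rewrite /E /C /f1.
  rewrite [(K / A * normc (g 0))%:C](_ : _ = (K / A)%:C * (g 0 / lambda)); last first.
    by rewrite g0_lambda rmorphM.
  by rewrite !rmorphD; ring.
have iH : dintegrable H.
  have [i2 _] := dintZ (K / A)^-1 id.
  by apply: eq_dintegrable i2 => z _; rewrite HE mulKf.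
have H0 : dint H = 0.
  have df1 : analytic_on_disc f1.
    by move=> z z1; apply: derivable_cmul; [exact: bf.1|exact: derivable_ccst].
  have coef e : 0 < e -> exists2 r, 0 < r & forall z, z != 0 -> normc z < r ->
      normc ((g z - g 0) / z ^+ N - s%:C * g 0 / a) < e.
    by move=> e0; exact: (power_branch_coef s N1 a0 dL LE e0).
  have eqn : s%:C * g 0 / a / N.+1%:R + g 0 * conjc a = g 0 * conjc b.
    have sC : (N.+1%:R^-1 * s)%:C = s%:C / N.+1%:R :> R[i].
      by rewrite mulrC rmorphM; congr (_ * _); rewrite fmorphV rmorph_nat.
    by rewrite abE -/s sC; ring.
  have PS := pairing_shift N1 df1 dg coef eqn (dintegrable_mu2 iH).
  have : (pi * dint H)%:E = 0%E by rewrite -(dint_mu2 iH); exact: PS.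
  by move=> /eqP; rewrite eqe mulf_eq0 gt_eqF ?pi_gt0//= => /eqP.
apply/eqP; rewrite -subr_eq0 -eck -ed; apply/eqP.
have -> : dint (fun z => complex.Re (E z) - C * complex.Re (f z * conjc (z ^+ N + b))) =
    dint (fun z => K / A * H z) by apply: eq_dint => z _.
by rewrite (dintZ (K / A) iH).2 H0 mulr0.
Qed.

Lemma power_extremal : is_unique_extremal p (fun z => z ^+ N + b) F.
Proof.
have [bF nF] := bergman_F.
have C0 : 0 < K / A * normc (g 0) by rewrite !mulr_gt0// invr_gt0.
exact: (extremal_criterion p1 C0 bF nF F_neq0 dual_pairing).
Qed.

End PowerExtremal.

Theorem theorem4p5 (R : realType) (N : nat) (p : R) (b a : R[i])
  (hN : (1 <= N)%N) (hp : 1 < p)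
  (hb : 1 + 1 / (N.+1)%:R * (1 - 2 / p) <= normc b)
  (ha : a = ((normc b
              + Num.sqrt (normc b ^+ 2 - 4 / (N.+1)%:R * (1 - 2 / p))) / 2)%:C
            * csgn b) :
  (exists h : R[i] -> R[i],
     is_power_branch (fun z : R[i] => z ^+ N + a) (2 / p) h) /\
  forall h : R[i] -> R[i],
    is_power_branch (fun z : R[i] => z ^+ N + a) (2 / p) h ->
    is_unique_extremal p (fun z : R[i] => z ^+ N + b)
      (fun z : R[i] => csgn (a / h 0) * (h z /
         ((normc a ^+ 2 + 1 / (N.+1)%:R) `^ (1 / p))%:C)).
Proof.
have p0 : 0 < p by exact: lt_trans hp.
set c := N.+1%:R^-1 * (1 - 2 / p).
have n1 : 1 <= N.+1%:R :> R by rewrite ler1n.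
have ni0 : 0 < N.+1%:R^-1 :> R by rewrite invr_gt0 (lt_le_trans ltr01).
have ni1 : N.+1%:R^-1 <= 1 :> R by rewrite invf_le1// (lt_le_trans ltr01).
have ip : 0 < p^-1 < 1 by rewrite invr_gt0 p0 invf_lt1.
have [c1 c2] : -1 < c /\ c < 1.
  move/andP: ip => [i0 i1].
  have cE : c = N.+1%:R^-1 - N.+1%:R^-1 * (2 * p^-1) by rewrite /c mulrBr mulr1.
  have q0 : 0 < N.+1%:R^-1 * (2 * p^-1) by rewrite mulr_gt0// mulr_gt0.
  have q1 : N.+1%:R^-1 * (2 * p^-1) < N.+1%:R^-1 * 2 by rewrite ltr_pM2l//; lra.
  have gen (n q : R) : n <= 1 -> 0 < q -> q < n * 2 -> -1 < n - q /\ n - q < 1.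
    by move=> ? ? ?; split; lra.
  by rewrite cE; exact: gen ni1 q0 q1.
have hb' : 1 + c <= normc b by move: hb; rewrite div1r.
have ha' : a = ((normc b + Num.sqrt (normc b ^+ 2 - 4 * c)) / 2)%:C * csgn b.
  by rewrite {1}ha /c mulrA.
have [a1 abE] := root_facts c1 c2 hb' ha'.
split.
  have [L [dL LE]] := log_branch_exists hN a1.
  by exists (fun z => cexp ((2 / p)%:C * L z)), L; split.
move=> h [L [dL LE hE]].
exact: (power_extremal hN hp a1 abE dL LE hE).
Qed.
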